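(* The following hold, where $f^\infty$ denotes the infinite loop of a problem $f$: \begin{enumerate} \item $\mathsf{C}_{2^{\mathbb N}}^\infty\equiv_{\mathrm W}\mathsf{C}_{2^{\mathbb N}}$ and $\mathsf{C}_{\mathbb N^{\mathbb N}}^\infty\equiv_{\mathrm W}\mathsf{C}_{\mathbb N^{\mathbb N}}$; \item $\mathsf{C}_{\mathbb N}<_{\mathrm W}\lim\equiv_{\mathrm W}\mathsf{C}_{\mathbb N}^\infty<_{\mathrm W}\lim^\infty$. \end{enumerate}
   Context: Problems. A represented space $(X,\delta_X)$ is a set $X$ with a surjective partial map $\delta_X:\subseteq\mathbb N^{\mathbb N}\to X$. A partial function $F:\subseteq\mathbb N^{\mathbb N}\to\mathbb N^{\mathbb N}$ is computable if there is a computable monotone (w.r.t. the prefix order) word function $\varphi:\mathbb N^*\to\mathbb N^*$ with $F(p)=\sup_{w\sqsubseteq p}\varphi(w)$ for all $p\in\mathrm{dom}(F)$. For a partial multivalued function $f:\subseteq X\rightrightarrows Y$ between represented spaces, $F:\subseteq\mathbb N^{\mathbb N}\to\mathbb N^{\mathbb N}$ is a realizer of $f$, written $F\vdash f$, if $\delta_YF(p)\in f\delta_X(p)$ for all $p\in\mathrm{dom}(f\delta_X)$. A problem is a multivalued function with a realizer. Composition: $g\circ f(x)=\{z:(\exists y\in f(x))\,z\in g(y)\}$ with $\mathrm{dom}(g\circ f)=\{x\in\mathrm{dom}(f):f(x)\subseteq\mathrm{dom}(g)\}$. The realizer version of $f$ is $f^{\mathrm r}:=\delta_Y^{-1}\circ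 f\circ\delta_X:\subseteq\mathbb N^{\mathbb N}\rightrightarrows\mathbb N^{\mathbb N}$. Tupling. $\langle q,p\rangle:=q(0)p(0)q(1)p(1)\dots$, and $\langle p_0,p_1,p_2,\dots\rangle$ is the standard countable tupling, e.g. $\langle p_0,p_1,\dots\rangle(\langle i,j\rangle)=p_i(j)$. $\langle\mathrm{id}\times f\rangle$ is the problem $\langle q,p\rangle\mapsto\{\langle q,r\rangle:r\in f(p)\}$. Universal function. $\Phi$ is a fixed standard total representation of a set of continuous partial functions on $\mathbb N^{\mathbb N}$ (with natural domains), where a name $q$ encodes the graph of a monotone word function approximating $\Phi_q$; $\mathsf U_q:=\Phi_q$, and $\mathsf U\langle q,p\rangle:=\mathsf U_q(p)$ is a computable partial function. The smn-theorem holds: for every computable (continuous) $F:\subseteq\mathbb N^{\mathbb N}\to\mathbb N^{\mathbb N}$ there is a total computable (continuous) $S$ with $\mathsf U_{S(q)}(p)=F\langle q,p\rangle$ for all $\langle q,p\rangle\in\mathrm{dom}(F)$. Infinite loop. For a problem $f:\subseteq\mathbb N^{\mathbb N}\rightrightarrows\mathbb N^{\mathbb N}$, $f^\infty(q_0):=\{\langle q_0,q_1,q_2,\dots\rangle:(\forall i)\ q_{i+1}\in\mathsf U\circ\langle\mathrm{id}\times f\rangle(q_i)\}$, with $\mathrm{dom}(f^\infty)$ the set of all $q_0$ such that $A_0:=\{q_0\}\subseteq\mathrm{dom}(\mathsf U\circ\langle\mathrm{id}\times f\rangle)$ and $A_{i+1}:=\mathsf U\circ\langle\mathrm{id}\times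 f\rangle(A_i)\subseteq\mathrm{dom}(\mathsf U\circ\langle\mathrm{id}\times f\rangle)$ for all $i$. For arbitrary $f$, $f^\infty:=(f^{\mathrm r})^\infty$. Weihrauch reducibility. $f\le_{\mathrm W}g$ if there are computable $H,K:\subseteq\mathbb N^{\mathbb N}\to\mathbb N^{\mathbb N}$ with $H\langle\mathrm{id},GK\rangle\vdash f$ whenever $G\vdash g$. $\equiv_{\mathrm W}$ is the induced equivalence; $f<_{\mathrm W}g$ means $f\le_{\mathrm W}g$ and $g\not\le_{\mathrm W}f$. Specific problems. $\mathsf C_X:\subseteq\mathcal A_-(X)\rightrightarrows X$, $B\mapsto B$, with domain the nonempty closed sets, where $\mathcal A_-(X)$ is the space of closed subsets of $X$ represented by negative information (a name of $B$ is an enumeration of basic open sets whose union is $X\setminus B$; basic open sets are singletons for $X=\mathbb N$ and cylinder sets for $X=2^{\mathbb N},\mathbb N^{\mathbb N}$). $\lim:\subseteq\mathbb N^{\mathbb N}\to\mathbb N^{\mathbb N}$, $\langle p_0,p_1,\dots\rangle\mapsto\lim_{i\to\infty}p_i$, is the limit map of Baire space, defined on convergent sequences. *)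

(* Defs.v *)
From HB Require Import structures.
From Stdlib Require Import Cantor.
From mathcomp Require Import all_boot.
From mathcomp Require Import boolp classical_sets functions cardinality.
From mathcomp Require Import topology cantor.

Set Implicit Arguments.
Unset Strict Implicit.
Unset Printing Implicit Defensive.

Local Open Scope classical_set_scope.

(* Programs for Kleene's mu-recursive functions.
   In [RPrim f g] the recursion variable is the first argument and [g] is
   applied to (counter, previous value, parameters); [RMin f] minimises over
   the first argument of [f]. *)
Inductive recfun : nat -> Type :=
| RZero n : recfun n
| RSucc : recfun 1
| RProj n (i : 'I_n) : recfun n
| RComp m n (f : recfun m) (g : 'I_m -> recfun n) : recfun n
| RPrim n (f : recfun n) (g : recfun n.+2) : recfun n.+1
| RMin n (f : recfun n.+1) : recfun n.

(* [eval e v y] : the partial function with program [e] is defined at [v] and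
   has value [y] there. *)
Fixpoint eval n (e : recfun n) : n.-tuple nat -> nat -> Prop :=
  match e in recfun n return n.-tuple nat -> nat -> Prop with
  | RZero n => fun _ y => y = 0
  | RSucc => fun v y => y = (thead v).+1
  | RProj n i => fun v y => y = tnth v i
  | RComp m n f g => fun v y =>
      exists2 w : m.-tuple nat, (forall i, eval (g i) v (tnth w i)) & eval f w y
  | RPrim n f g => fun v y =>
      nat_rect (fun=> nat -> Prop)
        (eval f [tuple of behead v])
        (fun k val_k z => exists2 r, val_k r &
           eval g [tuple of k :: r :: behead v] z)
        (thead v) y
  | RMin n f => fun v y =>
      eval f [tuple of y :: v] 0 /\
      forall z, z < y -> exists k, eval f [tuple of z :: v] k.+1
  end.

Definition computable_nat (f : nat -> nat) :=
  exists e : recfun 1, forall n, eval e [tuple n] (f n).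

Definition word := seq nat.

(* [CodeSeq.code] is an effective bijection from [word] onto [nat], with
   inverse [CodeSeq.decode]. *)
Definition computable_word (phi : word -> word) :=
  computable_nat (fun n => CodeSeq.code (phi (CodeSeq.decode n))).

Definition monotone_word (phi : word -> word) :=
  forall u v, prefix u v -> prefix (phi u) (phi v).

Definition baire : Type := prod_topology (fun _ : nat => nat).

HB.instance Definition _ := Pointed.on baire.
HB.instance Definition _ := Nbhs.on baire.
HB.instance Definition _ := Topological.on baire.

(* [r] is the supremum, in the prefix order, of the words [phi w] for [w] a
   finite prefix of [p]; the supremum is required to be an infinite sequence. *)
Definition word_sup (phi : word -> word) (p r : baire) :=
  (forall n, phi (mkseq p n) = mkseq r (size (phi (mkseq p n)))) /\
  (forall m, exists n, m <= size (phi (mkseq p n))).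

Section Multi.
Implicit Types X Y Z : Type.

(* Partial multivalued functions; [f] is undefined at [x] when [f x] is
   empty. *)
Definition multi X Y := X -> set Y.

Definition dom X Y (f : multi X Y) : set X := [set x | f x !=set0].

Definition mimage X Y (f : multi X Y) (A : set X) : set Y :=
  \bigcup_(x in A) f x.

Definition minv X Y (f : multi X Y) : multi Y X := fun y => [set x | f x y].

Definition mcomp X Y Z (g : multi Y Z) (f : multi X Y) : multi X Z :=
  fun x => [set z | f x `<=` dom g /\ exists2 y, f x y & g y z].

(* Partial functions are the single-valued multivalued functions. *)
Definition single_valued X Y (f : multi X Y) :=
  forall x y z, f x y -> f x z -> y = z.

End Multi.

Definition computable (F : multi baire baire) :=
  single_valued F /\
  exists phi, [/\ computable_word phi, monotone_word phi &
    forall p r, F p r -> word_sup phi p r].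

Definition bpair (q p : baire) : baire :=
  fun n => if odd n then p n./2 else q n./2.

Definition btuple (p : nat -> baire) : baire :=
  fun n => let: (i, j) := Cantor.of_nat n in p i j.

Definition component (s : baire) (i : nat) : baire :=
  fun j => s (Cantor.to_nat (i, j)).

Record repspace := RepSpace {
  repspace_carrier :> Type;
  delta : multi baire repspace_carrier;
  delta_single : single_valued delta;
  delta_surj : forall x, exists p, delta p x }.

Arguments delta : clear implicits.

Definition problem (X Y : repspace) := multi X Y.

Definition realizes (X Y : repspace) (F : multi baire baire)
    (f : problem X Y) :=
  single_valued F /\
  forall p, dom (mcomp f (delta X)) p ->
    exists2 r, F p r & exists2 y, delta Y r y & mcomp f (delta X) p y.

(* By the axiom of choice every multivalued function between represented
   spaces has a realizer, so [problem] carries no further condition. *)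
Lemma has_realizer (X Y : repspace) (f : problem X Y) :
  exists F, realizes F f.
Proof.
have H p : exists r, dom (mcomp f (delta X)) p ->
    exists2 y, delta Y r y & mcomp f (delta X) p y.
  have [[y fy]|nd] := pselect (dom (mcomp f (delta X)) p); last by exists p.
  by have [r ry] := delta_surj y; exists r => _; exists y.
have [F FP] := choice H.
exists (fun p => [set F p]); split; first by move=> p y z -> ->.
by move=> p /FP ?; exists (F p).
Qed.

Definition pair_id (F : multi baire baire) : multi baire baire :=
  fun p => [set s | exists2 r, F p r & s = bpair p r].

Definition weihrauch_le (X Y Z W : repspace)
    (f : problem X Y) (g : problem Z W) :=
  exists H K : multi baire baire,
    [/\ computable H, computable K &
     forall G : multi baire baire, realizes G g ->
       realizes (mcomp H (pair_id (mcomp G K))) f].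

Definition weihrauch_equiv (X Y Z W : repspace)
    (f : problem X Y) (g : problem Z W) :=
  weihrauch_le f g /\ weihrauch_le g f.

Definition weihrauch_lt (X Y Z W : repspace)
    (f : problem X Y) (g : problem Z W) :=
  weihrauch_le f g /\ ~ weihrauch_le g f.

Notation "f <=W g" := (weihrauch_le f g) (at level 70, no associativity).
Notation "f =W= g" := (weihrauch_equiv f g) (at level 70, no associativity).
Notation "f <W g" := (weihrauch_lt f g) (at level 70, no associativity).

Lemma id_single : single_valued (fun p : baire => [set p]).
Proof. by move=> x y z -> ->. Qed.

Lemma id_surj (p : baire) : exists q, [set q] p.
Proof. by exists p. Qed.

Definition baire_rep : repspace := RepSpace id_single id_surj.

Definition word_fun (q : baire) : word -> word :=
  fun w => CodeSeq.decode (q (CodeSeq.code w)).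

(* The function approximated by the word function encoded by [q], on its
   natural domain. If [word_fun q] fails to be monotone, [Phi q] is still a continuous partial
   function, defined where the values of [word_fun q] along the argument form
   compatible approximations of an infinite sequence; so [Phi] is total. *)
Definition Phi (q : baire) : multi baire baire :=
  fun p => [set r | word_sup (word_fun q) p r].

Definition U : multi baire baire :=
  fun s => [set r | exists q p, s = bpair q p /\ Phi q p r].

Definition id_times (f : multi baire baire) : multi baire baire :=
  fun s => [set t | exists q p, s = bpair q p /\
                    exists2 r, f p r & t = bpair q r].

Definition loop_step (f : multi baire baire) : multi baire baire :=
  mcomp U (id_times f).

Definition loop_stage (f : multi baire baire) (q0 : baire) (i : nat)
  : set baire := iter i (mimage (loop_step f)) [set q0].

Definition baire_inf_loop (f : multi baire baire) : multi baire baire :=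
  fun q0 => [set r |
    (forall i, loop_stage f q0 i `<=` dom (loop_step f)) /\
    exists q : nat -> baire,
      [/\ q 0 = q0, forall i, loop_step f (q i) (q i.+1) & r = btuple q]].

Definition realizer_version (X Y : repspace) (f : problem X Y)
  : multi baire baire := mcomp (minv (delta Y)) (mcomp f (delta X)).

Definition inf_loop (X Y : repspace) (f : problem X Y)
  : problem baire_rep baire_rep := baire_inf_loop (realizer_version f).

(* For [f] on Baire space itself, [f] and its realizer version coincide. *)
Lemma realizer_version_baire (f : problem baire_rep baire_rep) :
  realizer_version f = f.
Proof.
apply/funext => p; apply/seteqP; split=> r.
  by case=> _ [y [_ [x -> fpy]] ryE]; rewrite /minv /= in ryE; rewrite -ryE.
move=> fpr; split=> [y _|]; first by exists y.
exists r => //; split=> [x ->|]; first by exists r.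
by exists p.
Qed.

Record based_space := BasedSpace {
  based_top : topologicalType;
  based_delta : multi baire based_top;
  based_single : single_valued based_delta;
  based_surj : forall x, exists p, based_delta p x;
  base : nat -> set based_top;
  base_basis : basis (range base) }.

Arguments base : clear implicits.

Coercion repspace_of_based (X : based_space) : repspace :=
  RepSpace (@based_single X) (@based_surj X).

(* Negative information about a closed set [B] : the values [n.+1] of a name
   enumerate basic open sets whose union is the complement of [B]; the value
   [0] carries no information. *)
Definition neg_delta (X : based_space)
    : multi baire {B : set (based_top X) | closed B} :=
  fun p => [set B | ~` sval B = \bigcup_(n in [set n | exists i, p i = n.+1])
                                  base X n].

Lemma neg_single (X : based_space) : single_valued (@neg_delta X).
Proof.
move=> p [B cB] [C cC]; rewrite /neg_delta /= => hB hC; apply: eq_exist.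
by rewrite -[B]setCK hB -hC setCK.
Qed.

Lemma neg_surj (X : based_space) (B : {B : set (based_top X) | closed B}) :
  exists p, neg_delta p B.
Proof.
case: B => B cB.
exists (fun n => if `[< base X n `<=` ~` B >] then n.+1 else 0).
rewrite /neg_delta /=; apply/seteqP; split=> [x nBx|x [n [i]]]; last first.
  by case: asboolP => // sub [<-]; exact: sub.
have oB : open (~` B) by exact: closed_openC.
have nB : nbhs x (~` B) by exact: open_nbhs_nbhs.
have [V [[n _ <-] Vx] sub] := (base_basis X).2 x _ nB.
by exists n => //; exists n; case: asboolP.
Qed.

Definition neg_closed (X : based_space) : repspace :=
  RepSpace (@neg_single X) (@neg_surj X).

Definition closed_choice (X : based_space) : problem (neg_closed X) X :=
  fun B => sval B.

Arguments closed_choice : clear implicits.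

Definition nat_delta : multi baire nat := fun p => [set p 0].

Lemma nat_single : single_valued nat_delta.
Proof. by move=> p y z -> ->. Qed.

Lemma nat_surj n : exists p, nat_delta p n.
Proof. by exists (fun=> n). Qed.

Lemma nat_basis : basis (range (fun n : nat => [set n])).
Proof.
split=> [_ [n _ <-]|n A /nbhs_singleton An]; first exact: discrete_open.
by exists [set n]; [split=> //; exists n|move=> _ ->].
Qed.

Definition nat_space : based_space := BasedSpace nat_single nat_surj nat_basis.

Section Cylinder.
Variables (T : uniformType) (c : T -> nat).

(* Sequences over an alphabet [T] whose letters are identified with numbers by
   [c]. A word with letters outside the alphabet gives the empty set. *)
Definition cylinder (w : word) : set {ptws nat -> T} :=
  [set x | mkseq (fun i => c (x i)) (size w) = w].

Hypotheses (c_inj : injective c) (open1 : forall t : T, open [set t]).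

Lemma cylinder_basis :
  basis (range (fun n => cylinder (CodeSeq.decode n))).
Proof.
split=> [_ [k _ <-]|x A xA]; last first.
  pose F := filter_from [set: nat]
    (fun n => [set y : nat -> T | forall i, i < n -> y i = x i]).
  have FF : Filter F.
    apply: filter_from_filter; first by exists 0.
    move=> m n _ _; exists (maxn m n) => // y yx.
    by split=> i lti; apply: yx; rewrite leq_max lti ?orbT.
  have /(_ A xA) [n _ nA] : F --> x.
    apply/(@pointwise_cvgP nat T F x) => i B xB; exists i.+1 => // y yx /=.
    by rewrite yx //; exact: nbhs_singleton.
  exists (cylinder (mkseq (fun i => c (x i)) n)); last first.
    move=> y; rewrite /cylinder /= size_mkseq => yx; apply: nA => i ltin.
    apply: c_inj; have := congr1 (fun s => nth 0 s i) yx.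
    by rewrite !nth_mkseq.
  split; last by rewrite /cylinder /= size_mkseq.
  by exists (CodeSeq.code (mkseq (fun i => c (x i)) n)); rewrite ?CodeSeq.codeK.
rewrite openE => x xk.
have Fx : Filter (nbhs (x : {ptws nat -> T})) by exact: nbhs_filter.
have xP n : nbhs (x : {ptws nat -> T}) [set y | forall i, i < n -> y i = x i].
  elim: n => [|n IH]; first by apply: filterS filterT => y _ [].
  have Hn : nbhs (x : {ptws nat -> T}) [set y | y n = x n].
    apply: (@proj_continuous nat (fun=> T) n x [set x n]).
    by apply: open_nbhs_nbhs; split=> //; exact: open1.
  apply: filterS2 IH Hn => y yx yn i; rewrite ltnS leq_eqVlt => /orP[/eqP->//|].
  exact: yx.
apply: filterS (xP (size (CodeSeq.decode k))) => y yx.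
rewrite /cylinder /= -[RHS]xk; apply/eq_in_map => i; rewrite mem_iota => /= lti.
by rewrite yx.
Qed.

End Cylinder.

Lemma baire_basis :
  basis (range (fun n => cylinder (id : nat -> nat) (CodeSeq.decode n) : set baire)).
Proof. by apply: cylinder_basis => // t; exact: discrete_open. Qed.

Definition baire_space : based_space :=
  BasedSpace id_single id_surj baire_basis.

Definition cantor_delta : multi baire cantor_space :=
  fun p => [set x | forall n, p n = nat_of_bool (x n)].

Lemma cantor_single : single_valued cantor_delta.
Proof.
move=> p x y px py; apply/funext => n.
by have := px n; rewrite py; case: (x n); case: (y n).
Qed.

Lemma cantor_surj x : exists p, cantor_delta p x.
Proof. by exists (fun n => nat_of_bool (x n)). Qed.

Lemma cantor_basis :
  basis (range (fun n =>
    cylinder nat_of_bool (CodeSeq.decode n) : set cantor_space)).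
Proof.
apply: cylinder_basis => [|t]; first by case; case.
exact: discrete_open.
Qed.

Definition cantor_based : based_space :=
  BasedSpace cantor_single cantor_surj cantor_basis.

Definition C_nat := closed_choice nat_space.
Definition C_cantor := closed_choice cantor_based.
Definition C_baire := closed_choice baire_space.

Definition Lim : problem baire_rep baire_rep :=
  fun s => [set r : baire | component s i @[i --> \oo] --> r].

(* Main.v *)
(* Closed choice on a space X of sequences is closed under loops because the
   set of all sequences (x_0, x_1, ...) of correct answers is again closed: each
   instance is computed from the start of the loop and the earlier answers, so
   a wrong answer is eventually recognised, and a sequence without recognised
   error keeps the loop inside its domain. For the natural numbers, taking the
   least number not yet excluded as a guess gives all answers in the limit;
   conversely, the i-th step of a loop can ask for a modulus of convergence of
   the i-th coordinate of a sequence in Baire space. The programs that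
   drive these loops pass themselves on: a program S with
   Phi_S(r) = <S, E(r)> is obtained by course-of-values recursion on codes of
   words. Both separations are Baire category arguments: a problem reducible to
   choice on the natural numbers is continuous on some cylinder, one reducible
   to Lim has a point of continuity, whereas Lim computes a function with no
   continuous restriction to a cylinder and two iterations of Lim compute one
   without points of continuity. *)
From Stdlib Require Import Cantor.
From mathcomp Require Import all_boot zify.
From mathcomp Require Import boolp classical_sets topology.
Require Import Defs.

Set Implicit Arguments.
Unset Strict Implicit.
Unset Printing Implicit Defensive.

Local Open Scope classical_set_scope.

Arguments Cantor.to_nat : simpl never.
Arguments Cantor.of_nat : simpl never.

(** * Recursive functions *)

(** Realizers are arbitrary, so reductions are moved to [baire_reducible]: one query per instance,
    and every answer to it has to work. The word functions there need not be monotone, which lets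
    them be assembled from plain computations on finite prefixes; [mono] restores monotonicity once
    and for all. A loop step applies the program in the left half of a state, and the new state must
    again contain a program; this is why programs that return themselves are needed. For numbers,
    the closed set of answer sequences lies in Baire space and would only give a bound by choice on
    Baire space, hence the different argument through limits. The separations need different
    witnesses. The range of a sequence is discontinuous on every cylinder, yet it is continuous at
    surjections, as some point of continuity is unavoidable for a limit of continuous functions.
    This suffices against choice on numbers, where one answer serves a whole cylinder, but not
    against [Lim]. Being eventually zero changes its value densely, at the price of a second
    limit. *)

Definition rec_tuple n (f : n.-tuple nat -> nat) :=
  exists e : recfun n, forall v, eval e v (f v).

Lemma rec_tuple_ext n (f g : n.-tuple nat -> nat) :
  rec_tuple f -> f =1 g -> rec_tuple g.
Proof. by move=> [e He] fg; exists e => v; rewrite -fg. Qed.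

Lemma rec_tuple_proj n (i : 'I_n) : rec_tuple (fun v => tnth v i).
Proof. by exists (RProj i). Qed.

Lemma rec_tuple_comp m n (f : m.-tuple nat -> nat)
    (g : 'I_m -> n.-tuple nat -> nat) :
  rec_tuple f -> (forall i, rec_tuple (g i)) ->
  rec_tuple (fun v => f [tuple g i v | i < m]).
Proof.
move=> [e He] /choice[d Hd]; exists (RComp e d) => v /=.
by exists [tuple g i v | i < m] => // i; rewrite tnth_mktuple.
Qed.

Lemma rec_tuple_succ n (f : n.-tuple nat -> nat) :
  rec_tuple f -> rec_tuple (fun v => (f v).+1).
Proof.
move=> Hf; have H1 : @rec_tuple 1 (fun v => (thead v).+1) by exists RSucc.
apply: (rec_tuple_ext (rec_tuple_comp H1 (fun=> Hf))) => v.
by rewrite /thead tnth_mktuple.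
Qed.

Lemma rec_tuple_cst n k : rec_tuple (fun _ : n.-tuple nat => k).
Proof. by elim: k => [|k IH]; [exists (RZero n)|exact: rec_tuple_succ IH]. Qed.

Lemma rec_tuple_prim n (f : n.-tuple nat -> nat) (g : n.+2.-tuple nat -> nat)
    (h : n.-tuple nat -> nat) :
  rec_tuple f -> rec_tuple g -> rec_tuple h ->
  rec_tuple (fun v => nat_rect (fun=> nat) (f v)
    (fun k r => g [tuple of k :: r :: v]) (h v)).
Proof.
move=> [ef Hf] [eg Hg] [eh Hh].
exists (RComp (RPrim ef eg)
  (fun i : 'I_n.+1 => if unlift ord0 i is Some j then RProj j else eh)).
move=> v /=; exists [tuple of h v :: v].
  move=> i; case: unliftP => [j ->|->] /=; last by rewrite tnth0; exact: Hh.
  by rewrite tnthS.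
have H (u : n.+1.-tuple nat) : behead u = v -> forall N,
    nat_rect (fun=> nat -> Prop) (eval ef [tuple of behead u])
      (fun k val_k z => exists2 r, val_k r &
         eval eg [tuple of k :: r :: behead u] z) N
      (nat_rect (fun=> nat) (f v) (fun k r => g [tuple of k :: r :: v]) N).
  move=> uv; elim=> [|k IH] /=.
    by have -> : [tuple of behead u] = v by exact: val_inj.
  set b := nat_rect (fun=> nat) _ _ _ in IH *; exists b => //.
  have -> : [tuple of k :: b :: behead u] = [tuple of k :: b :: v].
    by apply: val_inj; rewrite /= uv.
  exact: Hg.
exact: (H [tuple of h v :: v]).
Qed.

Lemma rec_tuple_behead n (f : n.-tuple nat -> nat) :
  rec_tuple f -> rec_tuple (fun v : n.+1.-tuple nat => f [tuple of behead v]).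
Proof.
move=> Hf; apply: (rec_tuple_ext (rec_tuple_comp Hf
  (fun i => rec_tuple_proj (lift ord0 i)))) => v.
congr f; apply: eq_from_tnth => i; rewrite tnth_mktuple.
by rewrite {1}(tuple_eta v) tnthS.
Qed.

Lemma rec_tuple_rec n (f h : n.-tuple nat -> nat)
    (g : nat -> nat -> n.-tuple nat -> nat) :
  rec_tuple f -> rec_tuple h ->
  rec_tuple (fun w : n.+2.-tuple nat => g (thead w)
    (thead [tuple of behead w]) [tuple of behead [tuple of behead w]]) ->
  rec_tuple (fun v => nat_rect (fun=> nat) (f v) (fun k r => g k r v) (h v)).
Proof.
move=> Hf Hh Hg; apply: (rec_tuple_ext (rec_tuple_prim Hf Hg Hh)) => v.
elim: (h v) => //= k ->; rewrite !theadE; congr (g _ _ _); last exact: val_inj.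
Qed.

Lemma rec_tuple_0 n : rec_tuple (fun v : n.+1.-tuple nat => thead v).
Proof. exact: rec_tuple_proj. Qed.

Lemma rec_tuple_1 n :
  rec_tuple (fun v : n.+2.-tuple nat => thead [tuple of behead v]).
Proof. by apply: rec_tuple_behead; exact: rec_tuple_0. Qed.

Lemma rec_tuple_behead2 n (f : n.-tuple nat -> nat) : rec_tuple f ->
  rec_tuple (fun v : n.+2.-tuple nat =>
    f [tuple of behead [tuple of behead v]]).
Proof. by move=> Hf; exact: rec_tuple_behead (rec_tuple_behead Hf). Qed.

Section Arithmetic.
Variable n : nat.
Implicit Types f g h : n.-tuple nat -> nat.

Lemma rec_tuple_add f g :
  rec_tuple f -> rec_tuple g -> rec_tuple (fun v => f v + g v).
Proof.
move=> Hf Hg; apply: (rec_tuple_ext (@rec_tuple_rec n f g (fun k r _ => r.+1)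
  Hf Hg (rec_tuple_succ (rec_tuple_1 _)))) => v.
by elim: (g v) => [|k /= ->] /=; lia.
Qed.

Lemma rec_tuple_if f g h : rec_tuple f -> rec_tuple g -> rec_tuple h ->
  rec_tuple (fun v => if f v == 0 then g v else h v).
Proof.
move=> Hf Hg Hh; apply: (rec_tuple_ext (@rec_tuple_rec n g f
  (fun k r v => h v) Hg Hf (rec_tuple_behead2 Hh))) => v.
by case: (f v).
Qed.

Lemma rec_tuple_pred f : rec_tuple f -> rec_tuple (fun v => (f v).-1).
Proof.
move=> Hf; apply: (rec_tuple_ext (@rec_tuple_rec n (fun=> 0) f
  (fun k r v => k) (rec_tuple_cst _ _) Hf (rec_tuple_0 _))) => v.
by case: (f v).
Qed.

End Arithmetic.

Lemma rec_tuple_sub n (f g : n.-tuple nat -> nat) :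
  rec_tuple f -> rec_tuple g -> rec_tuple (fun v => f v - g v).
Proof.
move=> Hf Hg; apply: (rec_tuple_ext (@rec_tuple_rec n f g (fun k r _ => r.-1)
  Hf Hg (rec_tuple_pred (rec_tuple_1 _)))) => v.
by elim: (g v) => [|k /= ->] /=; lia.
Qed.

(** The recursion has the shape used inside [Cantor.to_nat], so that [to_natE] holds by
    conversion. *)
Definition triangle n := nat_rect (fun=> nat) 0 (fun i m => i.+1 + m) n.

Lemma to_natE x y : Cantor.to_nat (x, y) = y + triangle (y + x).
Proof. by []. Qed.

Lemma rec_tuple_triangle n (f : n.-tuple nat -> nat) :
  rec_tuple f -> rec_tuple (fun v => triangle (f v)).
Proof.
move=> Hf; apply: (@rec_tuple_rec n (fun=> 0) f (fun k r _ => k.+1 + r)) => //.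
  exact: rec_tuple_cst.
exact: rec_tuple_add (rec_tuple_succ (rec_tuple_0 _)) (rec_tuple_1 _).
Qed.

Lemma rec_tuple_pair n (f g : n.-tuple nat -> nat) : rec_tuple f ->
  rec_tuple g -> rec_tuple (fun v => Cantor.to_nat (f v, g v)).
Proof.
move=> Hf Hg; apply: rec_tuple_add => //.
by apply: rec_tuple_triangle; exact: rec_tuple_add.
Qed.

Definition diagonal n := nat_rect (fun=> nat) 0
  (fun k s => if triangle s.+1 - k.+1 == 0 then s.+1 else s) n.

Lemma diagonalE n : diagonal n = (Cantor.of_nat n).1 + (Cantor.of_nat n).2.
Proof.
have dS k : diagonal k.+1 =
  if triangle (diagonal k).+1 - k.+1 == 0 then (diagonal k).+1 else diagonal k.
  by [].
have tS k : triangle k.+1 = k.+1 + triangle k by [].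
elim: n => // n; rewrite dS => ->; have := Cantor.cancel_to_of n.
have -> : Cantor.of_nat n.+1 = let (x, y) := Cantor.of_nat n in
  if x is x'.+1 then (x', y.+1) else (y.+1, 0) by [].
case: (Cantor.of_nat n) => [x y]; rewrite to_natE tS [y + x]addnC /= => <-.
by case: x => [|x] /=; case: eqP; lia.
Qed.

Lemma rec_tuple_diagonal n (f : n.-tuple nat -> nat) :
  rec_tuple f -> rec_tuple (fun v => diagonal (f v)).
Proof.
move=> Hf; apply: (@rec_tuple_rec n (fun=> 0) f
  (fun k s _ => if triangle s.+1 - k.+1 == 0 then s.+1 else s)) => //.
  exact: rec_tuple_cst.
have H0 := @rec_tuple_0 n.+1; have H1 := @rec_tuple_1 n.
apply: rec_tuple_if => //; last exact: rec_tuple_succ.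
apply: rec_tuple_sub; last exact: rec_tuple_succ.
exact: rec_tuple_triangle (rec_tuple_succ H1).
Qed.

Lemma rec_tuple_snd n (f : n.-tuple nat -> nat) :
  rec_tuple f -> rec_tuple (fun v => (Cantor.of_nat (f v)).2).
Proof.
move=> Hf; have Hs := rec_tuple_diagonal Hf.
apply: (rec_tuple_ext (rec_tuple_sub Hf (rec_tuple_triangle Hs))) => v.
rewrite diagonalE -{1}[f v]Cantor.cancel_to_of.
by case: (Cantor.of_nat _) => x y; rewrite to_natE addnC [x + y]addnC addKn.
Qed.

Lemma rec_tuple_fst n (f : n.-tuple nat -> nat) :
  rec_tuple f -> rec_tuple (fun v => (Cantor.of_nat (f v)).1).
Proof.
move=> Hf; apply: (rec_tuple_ext
  (rec_tuple_sub (rec_tuple_diagonal Hf) (rec_tuple_snd Hf))) => v.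
by rewrite diagonalE addnK.
Qed.

Lemma computable_natP f : computable_nat f <-> rec_tuple (fun v :
  1.-tuple nat => f (thead v)).
Proof.
split=> -[e He]; exists e; last by move=> n; exact: (He [tuple n]).
by case/tupleP=> x t; rewrite (tuple0 t) theadE.
Qed.

Lemma rec_tuple_app n (F : nat -> nat) (f : n.-tuple nat -> nat) :
  computable_nat F -> rec_tuple f -> rec_tuple (fun v => F (f v)).
Proof.
move=> /computable_natP HF Hf.
apply: (rec_tuple_ext (rec_tuple_comp HF (fun=> Hf))) => v.
by rewrite /thead tnth_mktuple.
Qed.

(** Minimisation is applied to the distance of [F z] and [n], a sum of two truncated differences.
    Injectivity makes [G n] its only zero, so all smaller arguments give successors, as [RMin]
    demands. *)
Lemma computable_inverse (F G : nat -> nat) :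
  computable_nat F -> injective F -> cancel G F -> computable_nat G.
Proof.
move=> HF Finj GK.
have [e He] : rec_tuple (fun v : 2.-tuple nat =>
    (F (thead v) - thead [tuple of behead v]) +
    (thead [tuple of behead v] - F (thead v))).
  have H0 := rec_tuple_app HF (@rec_tuple_0 1); have H1 := @rec_tuple_1 0.
  by apply: rec_tuple_add; apply: rec_tuple_sub.
exists (RMin e) => n /=; split.
  have := He [tuple G n; n]; rewrite /thead !(tnth_nth 0) /= GK subnn.
  by congr (eval e _ _); exact: val_inj.
move=> z zn; exists (((F z - n) + (n - F z)).-1); rewrite prednK.
  have := He [tuple z; n]; rewrite /thead !(tnth_nth 0) /=.
  by congr (eval e _ _); exact: val_inj.
have : F z != n by apply: contraTneq zn => Fz; rewrite (Finj z (G n)) ?ltnn ?GK.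
by lia.
Qed.

(** * Computable functions between coded types *)

(** A number need not be a code, and [enc (dec n)] normalises it. The last field says that the
    identity is computable in the sense of [cmp]. *)
Structure coded := Coded {
  coded_sort :> Type;
  enc : coded_sort -> nat;
  dec : nat -> coded_sort;
  encK : cancel enc dec;
  computable_encdec : computable_nat (fun n => enc (dec n)) }.

Lemma computable_id : computable_nat id.
Proof. by apply/computable_natP; exact: rec_tuple_0. Qed.

Canonical nat_coded := @Coded nat id id (fun=> erefl) computable_id.

Lemma computable_word_id : computable_nat (fun n =>
  CodeSeq.code (CodeSeq.decode n)).
Proof. by rewrite (_ : (fun n => _) = id) ?CodeSeq.decodeK;
  [exact: computable_id|apply/funext => n; rewrite CodeSeq.decodeK]. Qed.

Canonical word_coded := @Coded (seq nat) _ _ CodeSeq.codeK computable_word_id.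

Lemma bool_encK : cancel nat_of_bool (fun n => n != 0).
Proof. by case. Qed.

Lemma computable_bool_id : computable_nat (fun n => nat_of_bool (n != 0)).
Proof.
apply/computable_natP; have H0 := @rec_tuple_0 0.
apply: (rec_tuple_ext
  (rec_tuple_if H0 (rec_tuple_cst _ 0) (rec_tuple_cst _ 1))) => v.
by case: (thead v).
Qed.

Canonical bool_coded := Coded bool_encK computable_bool_id.

Section Pair.
Variables A B : coded.

Definition pair_enc (p : A * B) := Cantor.to_nat (enc p.1, enc p.2).

Definition pair_dec n : A * B :=
  (dec A (Cantor.of_nat n).1, dec B (Cantor.of_nat n).2).

Lemma pair_encK : cancel pair_enc pair_dec.
Proof. by case=> a b; rewrite /pair_dec Cantor.cancel_of_to /= !encK. Qed.

Lemma computable_pair_id : computable_nat (fun n => pair_enc (pair_dec n)).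
Proof.
apply/computable_natP; have H0 := @rec_tuple_0 0.
apply: rec_tuple_pair.
  exact: rec_tuple_app (computable_encdec A) (rec_tuple_fst H0).
exact: rec_tuple_app (computable_encdec B) (rec_tuple_snd H0).
Qed.

End Pair.

Canonical pair_coded A B := Coded (@pair_encK A B) (@computable_pair_id A B).

Definition cmp (A B : coded) (f : A -> B) :=
  computable_nat (fun n => enc (f (dec A n))).

Lemma cmpP (A B : coded) (f : A -> B) :
  cmp f <-> rec_tuple (fun v : 1.-tuple nat => enc (f (dec A (thead v)))).
Proof. exact: computable_natP. Qed.

Section Closure.
Variable C : coded.

Lemma cmp_ext (A : coded) (f g : C -> A) : cmp f -> f =1 g -> cmp g.
Proof. by move=> Hf /funext <-. Qed.

Lemma cmp_id : cmp (fun x : C => x).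
Proof. exact: computable_encdec. Qed.

Lemma cmp_cst (A : coded) (a : A) : cmp (fun _ : C => a).
Proof. by apply/cmpP; exact: rec_tuple_cst. Qed.

Lemma cmp_comp (A B : coded) (g : A -> B) (f : C -> A) :
  cmp g -> cmp f -> cmp (fun x => g (f x)).
Proof.
move=> Hg /cmpP Hf; apply/cmpP.
apply: (rec_tuple_ext (rec_tuple_app Hg Hf)) => v /=; by rewrite encK.
Qed.

Lemma cmp_pair (A B : coded) (f : C -> A) (g : C -> B) :
  cmp f -> cmp g -> cmp (fun x => (f x, g x)).
Proof. by move=> /cmpP Hf /cmpP Hg; apply/cmpP; exact: rec_tuple_pair. Qed.

Lemma cmp_fst (A B : coded) (f : C -> A * B) : cmp f -> cmp (fun x => (f x).1).
Proof.
move=> /cmpP Hf; apply/cmpP; apply: (rec_tuple_ext (rec_tuple_fst Hf)) => v.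
by rewrite Cantor.cancel_of_to.
Qed.

Lemma cmp_snd (A B : coded) (f : C -> A * B) : cmp f -> cmp (fun x => (f x).2).
Proof.
move=> /cmpP Hf; apply/cmpP; apply: (rec_tuple_ext (rec_tuple_snd Hf)) => v.
by rewrite Cantor.cancel_of_to.
Qed.

Lemma cmp_rec (A : coded) (f : C -> A) (g : C -> nat -> A -> A) (h : C -> nat) :
  cmp f -> cmp (fun x : C * (nat * A) => g x.1 x.2.1 x.2.2) -> cmp h ->
  cmp (fun x => nat_rect (fun=> A) (f x) (g x) (h x)).
Proof.
move=> /cmpP Hf Hg /cmpP Hh; apply/cmpP.
have H0 := @rec_tuple_0 2; have H1 := @rec_tuple_1 1.
have H2 := rec_tuple_behead2 (@rec_tuple_0 0).
have HG := rec_tuple_app Hg (rec_tuple_pair H2 (rec_tuple_pair H0 H1)).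
apply: (rec_tuple_ext (@rec_tuple_rec 1 _ _ (fun k r v =>
  enc (g (dec C (thead v)) k (dec A r))) Hf Hh _)) => [|v] /=; last first.
  by elim: (h _) => //= k ->; rewrite encK.
apply: (rec_tuple_ext HG) => v.
by rewrite /= /pair_dec /= !(Cantor.cancel_of_to,
  =^~ surjective_pairing) /= ?Cantor.cancel_of_to.
Qed.

Lemma cmp_succ (f : C -> nat) : cmp f -> cmp (fun x => (f x).+1).
Proof. by move=> /cmpP Hf; apply/cmpP; exact: rec_tuple_succ. Qed.

Lemma cmp_pred (f : C -> nat) : cmp f -> cmp (fun x => (f x).-1).
Proof. by move=> /cmpP Hf; apply/cmpP; exact: rec_tuple_pred. Qed.

Lemma cmp_add (f g : C -> nat) : cmp f -> cmp g -> cmp (fun x => f x + g x).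
Proof. by move=> /cmpP Hf /cmpP Hg; apply/cmpP; exact: rec_tuple_add. Qed.

Lemma cmp_sub (f g : C -> nat) : cmp f -> cmp g -> cmp (fun x => f x - g x).
Proof. by move=> /cmpP Hf /cmpP Hg; apply/cmpP; exact: rec_tuple_sub. Qed.

Lemma cmp_if (A : coded) (b : C -> bool) (f g : C -> A) :
  cmp b -> cmp f -> cmp g -> cmp (fun x => if b x then f x else g x).
Proof.
move=> /cmpP Hb /cmpP Hf /cmpP Hg; apply/cmpP.
by apply: (rec_tuple_ext (rec_tuple_if Hb Hg Hf)) => v /=; case: (b _).
Qed.

Lemma cmp_nat_of_bool (b : C -> bool) :
  cmp b -> cmp (fun x => nat_of_bool (b x)).
Proof. by []. Qed.

Lemma cmp_eq0 (f : C -> nat) : cmp f -> cmp (fun x => f x == 0).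
Proof.
move=> /cmpP Hf; apply/cmpP.
apply: (rec_tuple_ext
  (rec_tuple_if Hf (rec_tuple_cst _ 1) (rec_tuple_cst _ 0))) => v /=.
by case: eqP.
Qed.

Lemma cmp_leq (f g : C -> nat) : cmp f -> cmp g -> cmp (fun x => f x <= g x).
Proof. by move=> Hf Hg; apply: cmp_eq0; exact: cmp_sub. Qed.

Lemma cmp_and (a b : C -> bool) : cmp a -> cmp b -> cmp (fun x => a x && b x).
Proof. by move=> Ha Hb; apply: cmp_if => //; exact: cmp_cst. Qed.

Lemma cmp_or (a b : C -> bool) : cmp a -> cmp b -> cmp (fun x => a x || b x).
Proof. by move=> Ha Hb; apply: cmp_if => //; exact: cmp_cst. Qed.

Lemma cmp_neg (a : C -> bool) : cmp a -> cmp (fun x => ~~ a x).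
Proof. by move=> Ha; apply: cmp_if => //; exact: cmp_cst. Qed.

Lemma cmp_eqn (f g : C -> nat) : cmp f -> cmp g -> cmp (fun x => f x == g x).
Proof.
move=> Hf Hg; apply: (cmp_ext (cmp_and (cmp_leq Hf Hg) (cmp_leq Hg Hf))) => x.
by rewrite eqn_leq.
Qed.

Lemma cmp_code (f : C -> word) : cmp f -> cmp (fun x => CodeSeq.code (f x)).
Proof. by []. Qed.

Lemma cmp_decode (f : C -> nat) :
  cmp f -> cmp (fun x => CodeSeq.decode (f x) : word).
Proof.
move=> /cmpP Hf; apply/cmpP; apply: (rec_tuple_ext Hf) => v /=.
by rewrite CodeSeq.decodeK.
Qed.

Lemma cmp_eqw (f g : C -> word) : cmp f -> cmp g -> cmp (fun x => f x == g x).
Proof.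
move=> Hf Hg; apply: (cmp_ext (cmp_eqn (cmp_code Hf) (cmp_code Hg))) => x.
by rewrite (can_eq CodeSeq.codeK).
Qed.

Lemma cmp_to_nat (f : C -> nat * nat) :
  cmp f -> cmp (fun x => Cantor.to_nat (f x)).
Proof.
move=> /cmpP Hf; apply/cmpP; apply: (rec_tuple_ext Hf) => v.
by rewrite /= /pair_enc; case: (f _).
Qed.

Lemma cmp_of_nat (f : C -> nat) : cmp f -> cmp (fun x => Cantor.of_nat (f x)).
Proof.
move=> /cmpP Hf; apply/cmpP; apply: (rec_tuple_ext Hf) => v /=.
by rewrite /pair_enc -surjective_pairing Cantor.cancel_to_of.
Qed.

End Closure.

Lemma cmp_mul (C : coded) (f g : C -> nat) :
  cmp f -> cmp g -> cmp (fun x => f x * g x).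
Proof.
move=> Hf Hg; have H : cmp (fun x => nat_rect (fun=> nat) 0
    (fun _ r => r + g x) (f x)).
  apply: cmp_rec => //; first exact: cmp_cst.
  apply: cmp_add; first by do 2!apply: cmp_snd; exact: cmp_id.
  by apply: cmp_comp Hg (cmp_fst (cmp_id _)).
by apply: (cmp_ext H) => x; elim: (f x) => //= k ->; rewrite mulSn addnC.
Qed.

Lemma cmp_exp2 (C : coded) (f : C -> nat) : cmp f -> cmp (fun x => 2 ^ f x).
Proof.
move=> Hf; have H : cmp (fun x => nat_rect (fun=> nat) 1
    (fun _ r => r + r) (f x)).
  apply: cmp_rec => //; first exact: cmp_cst.
  by apply: cmp_add; do 2!apply: cmp_snd; exact: cmp_id.
by apply: (cmp_ext H) => x; elim: (f x) => //= k ->; rewrite expnS mul2n addnn.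
Qed.

Lemma cmp_cons (C : coded) (f : C -> nat) (g : C -> word) :
  cmp f -> cmp g -> cmp (fun x => f x :: g x : word).
Proof.
move=> Hf Hg; have Hg' := cmp_code Hg.
have := cmp_mul (cmp_exp2 Hf) (cmp_succ (cmp_add Hg' Hg')).
move=> /cmpP H; apply/cmpP; apply: (rec_tuple_ext H) => v /=.
by rewrite addnn.
Qed.

Definition uncons_code n :=
  Cantor.to_nat (head 0 (CodeSeq.decode n.+1),
                 CodeSeq.code (behead (CodeSeq.decode n.+1))).

(* Adding a first letter is a bijection from pairs onto the nonzero codes, so
   its inverse is computable by minimisation. *)
Lemma computable_uncons : computable_nat uncons_code.
Proof.
pose F m := (CodeSeq.code
  ((Cantor.of_nat m).1 :: CodeSeq.decode (Cantor.of_nat m).2)).-1.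
have F1 m : (F m).+1 = CodeSeq.code
    ((Cantor.of_nat m).1 :: CodeSeq.decode (Cantor.of_nat m).2).
  by rewrite prednK //= muln_gt0 expn_gt0.
apply: (@computable_inverse F).
- have Hid := cmp_of_nat (cmp_id nat_coded).
  exact: (cmp_pred (cmp_code (cmp_cons (cmp_fst Hid)
    (cmp_decode (cmp_snd Hid))))).
- move=> m n /(congr1 succn); rewrite !F1 => /(can_inj CodeSeq.codeK) [E1].
  move=> /(can_inj CodeSeq.decodeK) E2; apply: Cantor.of_nat_inj.
  by rewrite [LHS]surjective_pairing E1 E2 -surjective_pairing.
- move=> n; apply: succn_inj.
  rewrite F1 /uncons_code Cantor.cancel_of_to CodeSeq.codeK.
  by have := CodeSeq.decodeK n.+1; case: (CodeSeq.decode n.+1).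
Qed.

Lemma cmp_head (C : coded) (f : C -> word) : cmp f -> cmp (fun x =>
  head 0 (f x)).
Proof.
move=> Hf; have H := cmp_comp (computable_uncons : cmp (uncons_code : nat ->
  nat))
  (cmp_pred (cmp_code Hf)).
have H' := cmp_if (cmp_eq0 (cmp_code Hf)) (cmp_cst _ 0) (cmp_fst (cmp_of_nat
  H)).
apply: (cmp_ext H') => x; rewrite /uncons_code Cantor.cancel_of_to.
case: eqP => [E|/eqP]; first by rewrite -[f x]CodeSeq.codeK E.
by rewrite -lt0n => /prednK ->; rewrite CodeSeq.codeK.
Qed.

Lemma cmp_behead (C : coded) (f : C -> word) : cmp f -> cmp (fun x =>
  behead (f x) : word).
Proof.
move=> Hf; have H := cmp_comp (computable_uncons : cmp (uncons_code : nat ->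
  nat))
  (cmp_pred (cmp_code Hf)).
have H' := cmp_if (cmp_eq0 (cmp_code Hf)) (cmp_cst _ ([::] : word))
  (cmp_decode (cmp_snd (cmp_of_nat H))).
apply: (cmp_ext H') => x;
  rewrite /uncons_code Cantor.cancel_of_to CodeSeq.codeK.
case: eqP => [E|/eqP]; first by rewrite -[f x]CodeSeq.codeK E.
by rewrite -lt0n => /prednK ->; rewrite CodeSeq.codeK.
Qed.

Lemma size_code (w : word) : size w <= CodeSeq.code w.
Proof.
elim: w => //= x w IH; rewrite -[(size w).+1]mul1n leq_mul ?expn_gt0 //.
by rewrite ltnS -addnn (leq_trans IH) // leq_addr.
Qed.

(** The fold runs as a primitive recursion on the pair of accumulator and unread suffix. The code of
    the word bounds its length; the surplus rounds change nothing, since the empty word has code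
    0. *)
Lemma cmp_foldl (C A : coded) (g : C -> A -> nat -> A) (a : C -> A)
    (f : C -> word) :
  cmp a -> cmp (fun x : C * (A * nat) => g x.1 x.2.1 x.2.2) -> cmp f ->
  cmp (fun x => foldl (g x) (a x) (f x)).
Proof.
move=> Ha Hg Hf.
pose step x (r : A * word) := if CodeSeq.code r.2 == 0 then r
  else (g x r.1 (head 0 r.2), behead r.2).
have H : cmp (fun x => (nat_rect (fun=> (A * word)%type) (a x, f x)
    (fun _ => step x) (CodeSeq.code (f x))).1).
  apply: cmp_fst; apply: (@cmp_rec C (pair_coded A word_coded)) => //.
    exact: cmp_pair.
  have H1 := cmp_fst (cmp_id (pair_coded C
    (pair_coded nat_coded (pair_coded A word_coded)))).
  have H2 := cmp_snd (cmp_snd (cmp_id (pair_coded C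
    (pair_coded nat_coded (pair_coded A word_coded))))).
  apply: (@cmp_if _ (pair_coded A word_coded)) => //.
    exact: (cmp_eq0 (cmp_code (cmp_snd H2))).
  apply: cmp_pair; last exact: cmp_behead (cmp_snd H2).
  exact: (cmp_comp Hg (cmp_pair H1 (cmp_pair (cmp_fst H2)
    (cmp_head (cmp_snd H2))))).
apply: (cmp_ext H) => x; set n := (X in nat_rect _ _ _ X).
have : size (f x) <= n := size_code _.
have nS k : nat_rect (fun=> (A * word)%type) (a x, f x) (fun=> step x) k =
    iter k (step x) (a x, f x) by elim: k => //= k ->.
rewrite nS; elim: n (a x) (f x) {nS} => [|n IH] b [|y s] // sn; rewrite iterSr.
  exact: (IH b [::]).
rewrite {2}/step ifF ?IH //.
by apply/negbTE; rewrite -lt0n (leq_trans _ (size_code _)).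
Qed.

Lemma cmp_rev (C : coded) (f : C -> word) : cmp f -> cmp (fun x => rev (f x) :
  word).
Proof.
move=> Hf; have H : cmp (fun x => foldl (fun s y => y :: s) ([::] :
  word) (f x) : word).
  apply: cmp_foldl => //; first exact: cmp_cst.
  have H2 := cmp_snd (cmp_id (pair_coded C (pair_coded word_coded nat_coded))).
  exact: cmp_cons (cmp_snd H2) (cmp_fst H2).
apply: (cmp_ext H) => x; elim/last_ind: (f x) => // s y IH.
by rewrite -cats1 foldl_cat /= IH cats1 rev_rcons.
Qed.

Lemma cmp_rcons (C : coded) (f : C -> word) (g : C -> nat) :
  cmp f -> cmp g -> cmp (fun x => rcons (f x) (g x) : word).
Proof.
move=> Hf Hg; apply: (cmp_ext (cmp_rev (cmp_cons Hg (cmp_rev Hf)))) => x.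
by rewrite rev_cons revK.
Qed.

Lemma cmp_size (C : coded) (f : C -> word) : cmp f -> cmp (fun x => size (f x)).
Proof.
move=> Hf; have H : cmp (fun x => foldl (fun n _ => n.+1) 0 (f x)).
  apply: cmp_foldl => //; first exact: cmp_cst.
  exact: (cmp_succ (cmp_fst (cmp_snd
    (cmp_id (pair_coded C (pair_coded nat_coded nat_coded)))))).
apply: (cmp_ext H) => x; elim/last_ind: (f x) => // s y IH.
by rewrite -cats1 foldl_cat /= IH cats1 size_rcons.
Qed.

Lemma cmp_nth (C : coded) (f : C -> word) (g : C -> nat) : cmp f -> cmp g ->
  cmp (fun x => nth 0 (f x) (g x)).
Proof.
move=> Hf Hg; have H : cmp (fun x => head 0 (nat_rect (fun=> word) (f x)
    (fun _ s => behead s) (g x))).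
  apply: cmp_head; apply: (@cmp_rec C word_coded) => //.
  apply: cmp_behead; do 2!apply: cmp_snd; exact: cmp_id.
apply: (cmp_ext H) => x; rewrite -nth0.
have -> : nat_rect (fun=> word) (f x) (fun _ s =>
  behead s) (g x) = drop (g x) (f x).
  elim: (g x) => [|k /= ->]; first by rewrite drop0.
  by elim: (f x) k => [|y s IH] [|k] //=; rewrite drop0.
by rewrite nth_drop addn0.
Qed.

Lemma cmp_mkseq (C : coded) (g : C -> nat -> nat) (n : C -> nat) :
  cmp (fun x : C * nat => g x.1 x.2) -> cmp n ->
  cmp (fun x => mkseq (g x) (n x) : word).
Proof.
move=> Hg Hn; have H : cmp (fun x => nat_rect (fun=> word) ([::] : word)
    (fun k s => rcons s (g x k)) (n x)).
  apply: (@cmp_rec C word_coded) => //; first exact: cmp_cst.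
  have H := cmp_id (pair_coded C (pair_coded nat_coded word_coded)).
  apply: cmp_rcons; first exact: cmp_snd (cmp_snd H).
  exact: (cmp_comp Hg (cmp_pair (cmp_fst H) (cmp_fst (cmp_snd H)))).
apply: (cmp_ext H) => x; elim: (n x) => //= k ->.
by rewrite /mkseq -addn1 iotaD map_cat cats1.
Qed.

Lemma cmp_take (C : coded) (f : C -> word) (n : C -> nat) : cmp f -> cmp n ->
  cmp (fun x => take (n x) (f x) : word).
Proof.
move=> Hf Hn; have Hs := cmp_size Hf.
have H : cmp (fun x => mkseq (nth 0 (f x))
    (if n x <= size (f x) then n x else size (f x)) : word).
  apply: cmp_mkseq; last by apply: cmp_if => //; exact: cmp_leq.
  have H := cmp_id (pair_coded C nat_coded).
  exact: cmp_nth (cmp_comp Hf (cmp_fst H)) (cmp_snd H).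
apply: (cmp_ext H) => x; apply: (@eq_from_nth _ 0).
  by rewrite size_mkseq size_take_min minnC /minn; case: ltnP; case: leqP; lia.
move=> i; rewrite size_mkseq => Hi; rewrite nth_mkseq // nth_take //.
by move: Hi; case: ifP; lia.
Qed.

Lemma cmp_prefix (C : coded) (f : C -> word) (g : C -> word) :
  cmp f -> cmp g -> cmp (fun x => prefix (f x) (g x)).
Proof.
move=> Hf Hg; apply: (cmp_ext (cmp_eqw Hf (cmp_take Hg (cmp_size Hf)))) => x.
by rewrite prefixE eq_sym.
Qed.

Lemma cmp_mem (C : coded) (g : C -> nat) (f : C -> word) : cmp g -> cmp f ->
  cmp (fun x => g x \in f x).
Proof.
move=> Hg Hf; have H : cmp (fun x => foldl (fun b y =>
  b || (y == g x)) false (f x)).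
  apply: cmp_foldl => //; first exact: cmp_cst.
  have H := cmp_id (pair_coded C (pair_coded bool_coded nat_coded)).
  apply: cmp_or; first exact: cmp_fst (cmp_snd H).
  exact: cmp_eqn (cmp_snd (cmp_snd H)) (cmp_comp Hg (cmp_fst H)).
apply: (cmp_ext H) => x; elim/last_ind: (f x) => // s y IH.
by rewrite -cats1 foldl_cat /= IH mem_cat inE eq_sym.
Qed.

Lemma cmp_has_iota (C : coded) (P : C -> nat -> bool) (n : C -> nat) :
  cmp (fun x : C * nat => P x.1 x.2) -> cmp n ->
  cmp (fun x => has (P x) (iota 0 (n x))).
Proof.
move=> HP Hn; have H : cmp (fun x => nat_rect (fun=> bool) false
    (fun k b => b || P x k) (n x)).
  apply: (@cmp_rec C bool_coded) => //; first exact: cmp_cst.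
  have H := cmp_id (pair_coded C (pair_coded nat_coded bool_coded)).
  apply: cmp_or; first exact: cmp_snd (cmp_snd H).
  exact: (cmp_comp HP (cmp_pair (cmp_fst H) (cmp_fst (cmp_snd H)))).
apply: (cmp_ext H) => x; elim: (n x) => // k IH.
by rewrite -[in RHS]addn1 iotaD has_cat /= orbF IH.
Qed.

Lemma cmp_odd (C : coded) (f : C -> nat) : cmp f -> cmp (fun x => odd (f x)).
Proof.
move=> Hf; have H : cmp (fun x => nat_rect (fun=> bool) false
    (fun k b => ~~ b) (f x)).
  apply: (@cmp_rec C bool_coded) => //; first exact: cmp_cst.
  by apply: cmp_neg; do 2!apply: cmp_snd; exact: cmp_id.
by apply: (cmp_ext H) => x; elim: (f x) => //= k ->.
Qed.

Lemma cmp_half (C : coded) (f : C -> nat) : cmp f -> cmp (fun x => (f x)./2).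
Proof.
move=> Hf; have H : cmp (fun x => nat_rect (fun=> nat) 0
    (fun k r => if odd k then r.+1 else r) (f x)).
  apply: cmp_rec => //; first exact: cmp_cst.
  have H := cmp_id (pair_coded C (pair_coded nat_coded nat_coded)).
  apply: cmp_if; [|exact: cmp_succ (cmp_snd (cmp_snd H))|
    exact: cmp_snd (cmp_snd H)].
  exact: cmp_odd (cmp_fst (cmp_snd H)).
apply: (cmp_ext H) => x; elim: (f x) => //= k ->.
by rewrite uphalf_half; case: odd.
Qed.

Lemma cmp_double (C : coded) (f : C -> nat) : cmp f -> cmp (fun x => (f x).*2).
Proof.
by move=> Hf; apply: (cmp_ext (cmp_add Hf Hf)) => x; rewrite addnn.
Qed.

Ltac cmp_step :=
  first [assumption |
  lazymatch goal with
  | |- cmp (fun _ => ?c) => apply: cmp_cst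
  | |- cmp (fun x => x) => apply: cmp_id
  | |- cmp fst => exact: (cmp_fst (cmp_id _))
  | |- cmp snd => exact: (cmp_snd (cmp_id _))
  | |- cmp id => apply: cmp_id
  | |- cmp predn => exact: (cmp_pred (cmp_id _))
  | |- cmp succn => exact: (cmp_succ (cmp_id _))
  | |- cmp half => exact: (cmp_half (cmp_id _))
  | |- cmp Cantor.of_nat => exact: (cmp_of_nat (cmp_id _))
  | |- cmp (fun x => (@?f x).1) => apply: cmp_fst
  | |- cmp (fun x => (@?f x).2) => apply: cmp_snd
  | |- cmp (fun x => pair (@?f x) (@?g x)) => apply: cmp_pair
  | |- cmp (fun x => S (@?f x)) => apply: cmp_succ
  | |- cmp (fun x => predn (@?f x)) => apply: cmp_pred
  | |- cmp (fun x => addn (@?f x) (@?g x)) => apply: cmp_add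
  | |- cmp (fun x => subn (@?f x) (@?g x)) => apply: cmp_sub
  | |- cmp (fun x => double (@?f x)) => apply: cmp_double
  | |- cmp (fun x => half (@?f x)) => apply: cmp_half
  | |- cmp (fun x => odd (@?f x)) => apply: cmp_odd
  | |- cmp (fun x => nat_of_bool (@?f x)) => apply: cmp_nat_of_bool
  | |- cmp (fun x => andb (@?f x) (@?g x)) => apply: cmp_and
  | |- cmp (fun x => orb (@?f x) (@?g x)) => apply: cmp_or
  | |- cmp (fun x => negb (@?f x)) => apply: cmp_neg
  | |- cmp (fun x => leq (@?f x) (@?g x)) => apply: cmp_leq
  | |- cmp (fun x => @eq_op _ (@?f x) (@?g x)) =>
      first [apply: cmp_eqn | apply: cmp_eqw]
  | |- cmp (fun x => CodeSeq.code (@?f x)) => apply: cmp_code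
  | |- cmp (fun x => CodeSeq.decode (@?f x)) => apply: cmp_decode
  | |- cmp (fun x => Cantor.to_nat (@?f x)) => apply: cmp_to_nat
  | |- cmp (fun x => Cantor.of_nat (@?f x)) => apply: cmp_of_nat
  | |- cmp (fun x => cons (@?f x) (@?g x)) => apply: cmp_cons
  | |- cmp (fun x => rcons (@?f x) (@?g x)) => apply: cmp_rcons
  | |- cmp (fun x => head 0 (@?f x)) => apply: cmp_head
  | |- cmp (fun x => behead (@?f x)) => apply: cmp_behead
  | |- cmp (fun x => size (@?f x)) => apply: cmp_size
  | |- cmp (fun x => nth 0 (@?f x) (@?g x)) => apply: cmp_nth
  | |- cmp (fun x => take (@?f x) (@?g x)) => apply: cmp_take
  | |- cmp (fun x => prefix (@?f x) (@?g x)) => apply: cmp_prefix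
  | |- cmp (fun x => mkseq (@?f x) (@?g x)) => apply: cmp_mkseq
  | |- cmp (fun x => foldl (@?f x) (@?g x) (@?h x)) => apply: cmp_foldl
  | |- cmp (fun x => has (@?f x) (iota 0 (@?g x))) => apply: cmp_has_iota
  | |- cmp (fun x => nat_rect _ (@?f x) (@?g x) (@?h x)) => apply: cmp_rec
  | |- cmp (fun x => in_mem (@?f x) (mem (@?g x))) => apply: cmp_mem
  | |- _ => apply: cmp_if
  end].

Ltac cmp_tac := repeat cmp_step.

(** * Words as approximations of sequences *)

Definition evt (P : nat -> Prop) := exists N, forall n, N <= n -> P n.

Lemma evtS (P Q : nat -> Prop) : (forall n, P n -> Q n) -> evt P -> evt Q.
Proof. by move=> PQ [N HN]; exists N => n /HN /PQ. Qed.

Lemma evtI (P Q : nat -> Prop) :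
  evt P -> evt Q -> evt (fun n => P n /\ Q n).
Proof.
move=> [M HM] [N HN]; exists (M + N) => n leMNn.
by split; [apply: HM|apply: HN]; lia.
Qed.

Lemma evtS2 (P Q R : nat -> Prop) :
  (forall n, P n -> Q n -> R n) -> evt P -> evt Q -> evt R.
Proof. by move=> H HP HQ; apply: evtS (evtI HP HQ) => n []; exact: H. Qed.

Lemma evtT (P : nat -> Prop) : (forall n, P n) -> evt P.
Proof. by exists 0. Qed.

Lemma evt_ge N : evt (fun n => N <= n).
Proof. by exists N. Qed.

Lemma evt_forall (P : nat -> nat -> Prop) M :
  (forall k, k < M -> evt (P k)) -> evt (fun n => forall k, k < M -> P k n).
Proof.
elim: M => [|M IH] HP; first by apply: evtT.
have H1 := IH (fun k kM => HP k (ltnW kM)).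
apply: evtS2 H1 (HP M (ltnSn M)) => n H1 H2 k; rewrite ltnS leq_eqVlt.
by case/orP=> [/eqP->|/H1].
Qed.

Definition wprefix (w : word) (p : baire) := w = mkseq p (size w).

Lemma wprefixP w p :
  wprefix w p <-> forall i, i < size w -> nth 0 w i = p i.
Proof.
split=> [-> i|H]; first by rewrite size_mkseq => lti; rewrite nth_mkseq.
apply: (@eq_from_nth _ 0); first by rewrite size_mkseq.
by move=> i lti; rewrite H // nth_mkseq.
Qed.

Lemma wprefix_mkseq (p : baire) n : wprefix (mkseq p n) p.
Proof. by rewrite /wprefix size_mkseq. Qed.

Lemma take_mkseq (p : nat -> nat) m n : m <= n ->
  take m (mkseq p n) = mkseq p m.
Proof.
by move=> le; rewrite /mkseq -map_take take_iota (minn_idPl le).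
Qed.

Lemma wprefix_take w p m : wprefix w p -> wprefix (take m w) p.
Proof.
move=> /wprefixP H; apply/wprefixP => i; rewrite size_take_min => lti.
by rewrite nth_take ?H //; lia.
Qed.

Lemma wprefix_prefix u v p : wprefix v p -> prefix u v -> wprefix u p.
Proof. by move=> vp; rewrite prefixE => /eqP <-; exact: wprefix_take. Qed.

Lemma wprefix_total u v p :
  wprefix u p -> wprefix v p -> size u <= size v -> prefix u v.
Proof.
by move=> -> ->; rewrite !size_mkseq => le;
  rewrite prefixE size_mkseq take_mkseq.
Qed.

Lemma wprefix_inj (p q : baire) :
  (forall M, exists w, [/\ M < size w, wprefix w p & wprefix w q]) -> p = q.
Proof.
move=> H; apply/funext => i; have [w [lti /wprefixP Hp /wprefixP Hq]] := H i.
by rewrite -Hp // Hq.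
Qed.

Definition wlim (s : nat -> word) (p : baire) :=
  evt (fun n => wprefix (s n) p) /\ forall M, evt (fun n => M <= size (s n)).

(** Stands in for [word_sup] without monotonicity: the lengths must eventually stay above every
    bound, not merely be unbounded. In this form approximations compose. *)
Definition tracks (psi : word -> word) (p r : baire) :=
  (forall n, wprefix (psi (mkseq p n)) r) /\ wlim (fun n => psi (mkseq p n)) r.

Lemma wlim_mkseq (p : baire) : wlim (mkseq p) p.
Proof.
split=> [|M]; first by apply: evtT => n; exact: wprefix_mkseq.
by apply: evtS (evt_ge M) => n; rewrite size_mkseq.
Qed.

Lemma wlim_app psi s p r : wlim s p -> tracks psi p r ->
  wlim (fun n => psi (s n)) r.
Proof.
move=> [H1 H2] [H3 [_ H4]]; split=> [|M].
  by apply: evtS H1 => n ->; exact: H3.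
have [N HN] := H4 M.
by apply: evtS2 H1 (H2 N) => n E le; rewrite E; exact: HN.
Qed.

Lemma tracks_comp psi phi p q r :
  tracks psi p q -> tracks phi q r -> tracks (fun w => phi (psi w)) p r.
Proof.
move=> [H1 H2] Hphi; split=> [n|]; last exact: wlim_app H2 Hphi.
by rewrite (H1 n); exact: Hphi.1.
Qed.

(** [ev k] is 0 while the letter at [k] is unknown and the successor of the letter once it is known.
    The test on the size stops the collection for good at the first unknown letter, so the result is
    always an initial segment. *)
Definition collect (ev : nat -> nat) N : word :=
  nat_rect (fun=> word) ([::] : word)
    (fun k s => if (size s == k) && (0 < ev k) then rcons s (ev k).-1 else s) N.

Lemma cmp_collect (C : coded) (ev : C -> nat -> nat) (N : C -> nat) :
  cmp (fun x : C * nat => ev x.1 x.2) -> cmp N ->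
  cmp (fun x => collect (ev x) (N x)).
Proof.
move=> Hev HN; apply: (@cmp_rec C word_coded (fun=> [::])
  (fun x k s => if (size s == k) && (0 < ev x k) then rcons s (ev x k).-1
     else s) N) => //; first exact: cmp_cst.
have H := cmp_id (pair_coded C (pair_coded nat_coded word_coded)).
have H1 := cmp_comp Hev (cmp_pair (cmp_fst H) (cmp_fst (cmp_snd H))).
by rewrite /= in H1; cmp_tac.
Qed.

Lemma collect_size ev M N : (forall k, k < M -> 0 < ev k) -> M <= N ->
  M <= size (collect ev N).
Proof.
move=> H; have HM K : K <= M -> size (collect ev K) = K.
  elim: K => //= K IH KM; rewrite IH ?eqxx ?H //= ?size_rcons ?IH //; lia.
elim: N => [|N IH] /=; first by rewrite leqn0 => /eqP ->.
rewrite leq_eqVlt => /orP[/eqP E|];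
  first by have /= -> := HM N.+1 (eq_leq (esym E)); rewrite E.
by rewrite ltnS => /IH le; case: ifP => // _; rewrite size_rcons leqW.
Qed.

Lemma wprefix_collect ev N (r : baire) :
  (forall k, ev k = 0 \/ ev k = (r k).+1) -> wprefix (collect ev N) r.
Proof.
move=> H; elim: N => // N IH /=; case: ifP => // /andP[/eqP E].
case: (H N) => -> // _; rewrite /wprefix size_rcons E {1}IH E.
by rewrite /mkseq -[N.+1]addn1 iotaD map_cat cats1.
Qed.

Lemma wlim_collect (ev : nat -> nat -> nat) (len : nat -> nat) (r : baire) :
  evt (fun n => forall k, ev n k = 0 \/ ev n k = (r k).+1) ->
  (forall k, evt (fun n => 0 < ev n k)) -> (forall M, evt (fun n =>
    M <= len n)) ->
  wlim (fun n => collect (ev n) (len n)) r.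
Proof.
move=> H1 H2 H3; split=> [|M]; first by apply: evtS H1 => n;
  exact: wprefix_collect.
have H4 := evt_forall (fun k (_ : k < M) => H2 k).
by apply: evtS2 H4 (H3 M) => n H4 H5; exact: collect_size.
Qed.

Lemma tracks_collect (ev : word -> nat -> nat) (p r : baire) :
  (forall n k, ev (mkseq p n) k = 0 \/ ev (mkseq p n) k = (r k).+1) ->
  (forall k, evt (fun n => 0 < ev (mkseq p n) k)) ->
  tracks (fun w => collect (ev w) (size w)) p r.
Proof.
move=> H1 H2; split=> [n|]; first exact: wprefix_collect.
apply: wlim_collect => // [|M]; first exact: evtT.
by apply: evtS (evt_ge M) => n; rewrite size_mkseq.
Qed.

Definition look (w : word) k := if k < size w then (nth 0 w k).+1 else 0.

Lemma cmp_look (C : coded) (f : C -> word) (g : C -> nat) :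
  cmp f -> cmp g -> cmp (fun x => look (f x) (g x)).
Proof. by move=> Hf Hg; rewrite /look; cmp_tac. Qed.

Lemma look_wprefix w p k : wprefix w p -> look w k = 0 \/ look w k = (p k).+1.
Proof.
by move=> /wprefixP H; rewrite /look; case: ifP => [/H ->|]; [right|left].
Qed.

Lemma look_gt0 w k : (0 < look w k) = (k < size w).
Proof. by rewrite /look; case: ifP. Qed.

Definition reindex (g : nat -> nat) (w : word) :=
  collect (fun k => look w (g k)) (size w).

Lemma wprefix_reindex g w p :
  wprefix w p -> wprefix (reindex g w) (fun k => p (g k)).
Proof. by move=> H; apply: wprefix_collect => k; exact: look_wprefix. Qed.

Lemma wlim_reindex g s p :
  wlim s p -> wlim (fun n => reindex g (s n)) (fun k => p (g k)).
Proof.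
move=> [H1 H2]; apply: wlim_collect => //.
  by apply: evtS H1 => n Hn k; exact: look_wprefix.
by move=> k; apply: evtS (H2 (g k).+1) => n; rewrite look_gt0.
Qed.

Lemma tracks_reindex g psi p r :
  tracks psi p r -> tracks (fun w => reindex g (psi w)) p (fun k => r (g k)).
Proof.
move=> [H1 H2]; split=> [n|]; first exact: wprefix_reindex.
exact: wlim_reindex.
Qed.

Lemma cmp_reindex (C : coded) (g : C -> nat -> nat) (f : C -> word) :
  cmp (fun x : C * nat => g x.1 x.2) -> cmp f ->
  cmp (fun x => reindex (g x) (f x)).
Proof.
move=> Hg Hf; apply: cmp_collect; last exact: cmp_size.
by apply: cmp_look => //; exact: cmp_comp Hf (cmp_fst (cmp_id _)).
Qed.

Lemma tracks_id p : tracks id p p.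
Proof. by split=> [n|]; [exact: wprefix_mkseq|exact: wlim_mkseq]. Qed.

Definition left_half (q : baire) : baire := fun k => q k.*2.
Definition right_half (q : baire) : baire := fun k => q k.*2.+1.

Lemma bpairK1 q p : left_half (bpair q p) = q.
Proof. by apply/funext => k; rewrite /left_half /bpair odd_double doubleK. Qed.

Lemma bpairK2 q p : right_half (bpair q p) = p.
Proof.
by apply/funext => k; rewrite /right_half /bpair /= odd_double /= uphalf_double.
Qed.

Lemma bpair_eta q : q = bpair (left_half q) (right_half q).
Proof.
apply/funext => k; rewrite /left_half /right_half /bpair.
by rewrite -{1}(odd_double_half k); case: odd.
Qed.

Lemma component_btuple q i : component (btuple q) i = q i.
Proof.
by apply/funext => j; rewrite /component /btuple Cantor.cancel_of_to.
Qed.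

Definition wleft := reindex double.
Definition wright := reindex (fun k => k.*2.+1).
Definition wcomponent i := reindex (fun k => Cantor.to_nat (i, k)).

Definition wpair (u v : word) :=
  collect (fun k => if odd k then look v k./2 else look u k./2)
          (size u + size v).

Lemma wprefix_pair u v q p :
  wprefix u q -> wprefix v p -> wprefix (wpair u v) (bpair q p).
Proof.
move=> uq vp; apply: wprefix_collect => k; rewrite /bpair.
by case: odd; exact: look_wprefix.
Qed.

Lemma wlim_pair s t q p :
  wlim s q -> wlim t p -> wlim (fun n => wpair (s n) (t n)) (bpair q p).
Proof.
move=> [H1 H2] [H3 H4]; apply: wlim_collect.
- apply: evtS2 H1 H3 => n H1 H3 k; rewrite /bpair.
  by case: odd; exact: look_wprefix.
- move=> k; case: odd; [move: (H4 k./2.+1)|move: (H2 k./2.+1)];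
    by apply: evtS => n; rewrite look_gt0.
- by move=> M; apply: evtS (H2 M) => n; lia.
Qed.

Lemma tracks_pair psi phi p q r : tracks psi p q -> tracks phi p r ->
  tracks (fun w => wpair (psi w) (phi w)) p (bpair q r).
Proof.
move=> [H1 H2] [H3 H4]; split=> [n|]; first exact: wprefix_pair.
exact: wlim_pair.
Qed.

Section CmpHalves.
Variable C : coded.
Implicit Types f g : C -> word.

Lemma cmp_wleft f : cmp f -> cmp (fun x => wleft (f x)).
Proof. by move=> Hf; apply: cmp_reindex => //; cmp_tac. Qed.

Lemma cmp_wright f : cmp f -> cmp (fun x => wright (f x)).
Proof. by move=> Hf; apply: cmp_reindex => //; cmp_tac. Qed.

Lemma cmp_wcomponent (i : C -> nat) f :
  cmp i -> cmp f -> cmp (fun x => wcomponent (i x) (f x)).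
Proof.
move=> Hi Hf; apply: cmp_reindex => //; cmp_tac.
exact: cmp_comp Hi (cmp_fst (cmp_id _)).
Qed.

Lemma cmp_wpair f g : cmp f -> cmp g -> cmp (fun x => wpair (f x) (g x)).
Proof.
move=> Hf Hg; have H := cmp_id (pair_coded C nat_coded).
have Hf' := cmp_comp Hf (cmp_fst H); have Hg' := cmp_comp Hg (cmp_fst H).
by apply: cmp_collect; [apply: cmp_if; [|apply: cmp_look..]|]; cmp_tac.
Qed.

End CmpHalves.

Lemma tracks_left q p : tracks wleft (bpair q p) q.
Proof.
by have := tracks_reindex double (tracks_id (bpair q p));
  rewrite [X in tracks _ _ X](bpairK1 q p).
Qed.

Lemma tracks_right q p : tracks wright (bpair q p) p.
Proof.
have := tracks_reindex (fun k => k.*2.+1) (tracks_id (bpair q p)).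
by rewrite [X in tracks _ _ X](bpairK2 q p).
Qed.

(** * Monotone word functions and Weihrauch reducibility *)

(* Any word function whose values along [p] approximate [r] can be made
   monotone without losing an approximation: a value that does not extend the
   one kept so far is dropped, and along [p] a dropped value is shorter. *)
Definition mono_state (psi : word -> word) (w : word) : word * word :=
  foldl (fun a y => (rcons a.1 y,
    if prefix a.2 (psi (rcons a.1 y)) then psi (rcons a.1 y) else a.2))
    ([::], psi [::]) w.

Definition mono psi w := (mono_state psi w).2.

Lemma mono_state_rcons psi w y : mono_state psi (rcons w y) =
  let a := mono_state psi w in (rcons a.1 y,
    if prefix a.2 (psi (rcons a.1 y)) then psi (rcons a.1 y) else a.2).
Proof. by rewrite /mono_state -cats1 foldl_cat. Qed.

Lemma mono_state1 psi w : (mono_state psi w).1 = w.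
Proof.
by elim/last_ind: w => // w y IH; rewrite mono_state_rcons /= IH.
Qed.

Lemma mono_rcons psi w y : mono psi (rcons w y) =
  if prefix (mono psi w) (psi (rcons w y)) then psi (rcons w y) else mono psi w.
Proof. by rewrite /mono mono_state_rcons /= mono_state1. Qed.

Lemma mono_monotone psi : monotone_word (mono psi).
Proof.
move=> u v /prefixP[w ->]; elim/last_ind: w => [|w y IH].
  by rewrite cats0 prefix_refl.
by rewrite -rcons_cat mono_rcons; case: ifP => // /(prefix_trans IH).
Qed.

Lemma cmp_mono psi : cmp psi -> cmp (mono psi).
Proof.
move=> Hpsi; apply: (@cmp_snd word_coded word_coded word_coded (mono_state
  psi)).
apply: (@cmp_foldl word_coded (pair_coded word_coded word_coded)
  (fun _ a y => (rcons a.1 y,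
    if prefix a.2 (psi (rcons a.1 y)) then psi (rcons a.1 y) else a.2))
    (fun=> ([::], psi [::])) id); [exact: cmp_cst| |exact: cmp_id].
have H := cmp_id (pair_coded word_coded
  (pair_coded (pair_coded word_coded word_coded) nat_coded)).
have H1 := cmp_fst (cmp_snd H).
have H2 := cmp_comp Hpsi (cmp_rcons (cmp_fst H1) (cmp_snd (cmp_snd H))).
by rewrite /= in H2; cmp_tac.
Qed.

Lemma mkseqS (p : nat -> nat) n : mkseq p n.+1 = rcons (mkseq p n) (p n).
Proof. by rewrite /mkseq -addn1 iotaD map_cat cats1. Qed.

Lemma mono_tracks psi p r : tracks psi p r -> word_sup (mono psi) p r.
Proof.
move=> [H1 [_ H2]].
have H n : wprefix (mono psi (mkseq p n)) r /\
    size (psi (mkseq p n)) <= size (mono psi (mkseq p n)).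
  elim: n => [|n [IH1 IH2]]; first by split=> //; exact: (H1 0).
  rewrite mkseqS mono_rcons -mkseqS; case: ifP => // np; split=> //.
  by rewrite leqNgt; apply: contraFN np => /ltnW;
    exact: wprefix_total IH1 (H1 n.+1).
split=> [n|M]; first exact: (H n).1.
by have [N /(_ N (leqnn _)) HN] := H2 M; exists N; apply: leq_trans HN (H N).2.
Qed.

Lemma word_sup_tracks phi p r : monotone_word phi -> word_sup phi p r ->
  tracks phi p r.
Proof.
move=> Hm [H1 H2]; split=> //; split=> [|M]; first exact: evtT.
have [N HN] := H2 M; exists N => n Nn; apply: leq_trans HN _.
apply: size_prefix; apply: Hm.
by apply: (wprefix_total (wprefix_mkseq p N) (wprefix_mkseq p n));
  rewrite !size_mkseq.
Qed.

Lemma word_sup_uniq phi p r r' : word_sup phi p r -> word_sup phi p r' ->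
  r = r'.
Proof.
move=> [H1 H2] [H3 _]; apply: wprefix_inj => M.
by have [N HN] := H2 M.+1; exists (phi (mkseq p N)); split.
Qed.

(* Weihrauch reducibility on names; the word functions need not be monotone. *)
Definition baire_reducible (f g : multi baire baire) :=
  exists h k : word -> word, [/\ cmp h, cmp k &
    forall p, dom f p -> exists p', [/\ tracks k p p', dom g p' &
      forall r, g p' r -> exists2 t, tracks h (bpair p r) t & f p t]].

Lemma baire_reducible_trans f g e : baire_reducible f g ->
  baire_reducible g e -> baire_reducible f e.
Proof.
move=> [h1 [k1 [Hh1 Hk1 H1]]] [h2 [k2 [Hh2 Hk2 H2]]].
exists (fun w => h1 (wpair (wleft w) (h2 (wpair (k1 (wleft w)) (wright w))))).
exists (fun w => k2 (k1 w)); split.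
- have Hi := cmp_id word_coded; apply: (cmp_comp Hh1); apply: cmp_wpair.
    exact: cmp_wleft.
  apply: (cmp_comp Hh2); apply: cmp_wpair; last exact: cmp_wright.
  by apply: (cmp_comp Hk1); exact: cmp_wleft.
- exact: cmp_comp Hk2 Hk1.
- move=> p /H1[p' [kp gp' hp']]; have [p'' [kp' ep'' hp'']] := H2 _ gp'.
  exists p''; split=> //; first exact: tracks_comp kp kp'.
  move=> r /hp''[t ht /hp'[u hu fu]]; exists u => //.
  apply: (tracks_comp _ hu); apply: tracks_pair; first exact: tracks_left.
  apply: (tracks_comp _ ht); apply: tracks_pair; last exact: tracks_right.
  exact: tracks_comp (tracks_left _ _) kp.
Qed.

Section Weihrauch.
Variables X Y Z W : repspace.
Implicit Types (f : problem X Y) (g : problem Z W).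

Lemma realizer_versionE (A B : repspace) (f : problem A B) p r :
  realizer_version f p r <->
  exists2 y, delta B r y & mcomp f (delta A) p y.
Proof.
split=> [[_ [y]]|[y ry fpy]]; first by exists y.
split; last by exists y.
by move=> z _; have [s sz] := delta_surj z; exists s.
Qed.

Lemma dom_realizer_version (A B : repspace) (f : problem A B) p :
  dom (realizer_version f) p <-> dom (mcomp f (delta A)) p.
Proof.
split=> -[y]; first by case/realizer_versionE => z _ ?; exists z.
by have [s sy] := delta_surj y => ?; exists s; apply/realizer_versionE;
  exists y.
Qed.

Lemma realizesP (A B : repspace) (f : problem A B) F : realizes F f <->
  single_valued F /\ forall p, dom (realizer_version f) p ->
    exists2 r, F p r & realizer_version f p r.
Proof.
split=> -[Fs HF]; split=> // p /dom_realizer_version /HF[r Fr H];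
  by exists r => //; apply/realizer_versionE.
Qed.

Lemma single_mcomp (A B D : Type) (f : multi A B) (g : multi B D) :
  single_valued f -> single_valued g -> single_valued (mcomp g f).
Proof.
move=> fs gs x y z [_ [u fxu guy]] [_ [v fxv gvz]].
by move: gvz; rewrite -(fs _ _ _ fxu fxv) => /(gs _ _ _ guy).
Qed.

Lemma mcomp_single (A B D : Type) (f : multi A B) (g : multi B D) x y z :
  single_valued f -> f x y -> g y z -> mcomp g f x z.
Proof.
move=> fs fxy gyz; split; last by exists y.
by move=> y' /(fs _ _ _ fxy) <-; exists z.
Qed.

Lemma single_pair_id F : single_valued F -> single_valued (pair_id F).
Proof. by move=> Fs p _ _ [r Fr ->] [s /(Fs _ _ _ Fr) -> ->]. Qed.

Lemma computable_word_sup psi : cmp psi ->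
  computable (fun p => [set r | word_sup (mono psi) p r]).
Proof.
move=> Hpsi; split; first by move=> p r s; exact: word_sup_uniq.
by exists (mono psi); split=> //; [exact: cmp_mono|exact: mono_monotone].
Qed.

Lemma computable_tracks F : computable F ->
  exists2 psi, cmp psi & forall p r, F p r -> tracks psi p r.
Proof.
move=> [_ [phi [Hphi Hmono HF]]]; exists phi => // p r Fpr.
by apply: word_sup_tracks => //; exact: HF.
Qed.

Lemma baire_reducible_weihrauch f g :
  baire_reducible (realizer_version f) (realizer_version g) -> f <=W g.
Proof.
move=> [h [k [Hh Hk H]]].
have [[Hs _] [Ks _]] := (computable_word_sup Hh, computable_word_sup Hk).
exists (fun p => [set r | word_sup (mono h) p r]).
exists (fun p => [set r | word_sup (mono k) p r]).
split; [exact: computable_word_sup..|] => G /realizesP[Gs HG].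
have GKs := single_mcomp Ks Gs; have Ps := single_pair_id GKs.
apply/realizesP; split; first exact: single_mcomp.
move=> p /H[p' [kp /HG[r Gr gr] /(_ _ gr)[t ht fpt]]]; exists t => //.
apply: (mcomp_single Ps) (mono_tracks ht); exists r => //.
exact: mcomp_single Ks (mono_tracks kp) Gr.
Qed.

(** Realizers may be chosen independently at each name: prescribed at [p0], by choice elsewhere,
    undefined outside the domain. The last property forces a successful reduction to query only
    names in the domain of [g]. *)
Lemma realizer_at g p0 r0 :
  (dom (realizer_version g) p0 -> realizer_version g p0 r0) ->
  exists G, [/\ realizes G g, forall r, G p0 r -> r = r0 &
    forall p r, G p r -> dom (realizer_version g) p].
Proof.
move=> gr0.
have /choice[c Hc] p : exists r, dom (realizer_version g) p ->
  realizer_version g p r.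
  have [[r gr]|nd] := pselect (dom (realizer_version g) p); first by exists r.
  by exists p.
exists (fun p => [set r | dom (realizer_version g) p /\
  r = if `[< p = p0 >] then r0 else c p]); split.
- apply/realizesP; split; first by move=> p r s [_ ->] [_ ->].
  move=> p dp; exists (if `[< p = p0 >] then r0 else c p) => //.
  by case: asboolP => [E|_]; [rewrite E; apply: gr0; rewrite -E|exact: Hc].
- by move=> r [_]; case: asboolP.
- by move=> p r [].
Qed.

(** As [K] is single-valued, the query does not depend on the realizer. Each answer [r] to it is
    then tested with a realizer that returns [r] there. *)
Lemma weihrauch_baire_reducible f g :
  f <=W g -> baire_reducible (realizer_version f) (realizer_version g).
Proof.
move=> [H [K [cH cK HK]]].
have [h Hh hH] := computable_tracks cH; have [k Hk kK] := computable_tracks cK.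
exists h, k; split=> // p dp.
have get p0 r0 : (dom (realizer_version g) p0 -> realizer_version g p0 r0) ->
    exists p' r t, [/\ K p p', dom (realizer_version g) p', p' = p0 -> r = r0,
      H (bpair p r) t & realizer_version f p t].
  move=> /realizer_at[G [/HK /realizesP[_ /(_ p dp)[t [_ [s]]]]]].
  move=> [r [_ [p' Kp Gp]] ->] Ht ft HG domG.
  exists p', r, t; split=> //; first exact: domG Gp.
  by move=> E; apply: HG; rewrite -E.
(* Any realizer reveals the query; [p] is the prescribed name only because some name is required. *)
have [p' Kp dp'] : exists2 p', K p p' & dom (realizer_version g) p'.
  have [[r gr]|nd] := pselect (dom (realizer_version g) p).
    by have [p' [_ [_ [? ? _ _ _]]]] := get p r (fun=> gr); exists p'.
  by have [p' [_ [_ [? ? _ _ _]]]] := get p p (fun d => False_ind _ (nd d));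
    exists p'.
exists p'; split=> //; first exact: kK.
move=> r gr; have [p'' [r' [t [Kp' _ E Ht ft]]]] := get p' r (fun=> gr).
by exists t => //; apply: hH; rewrite -(E (cK.1 _ _ _ Kp' Kp)).
Qed.

End Weihrauch.

(** * Infinite loops *)

Lemma loop_stepP f q q' : loop_step f q q' <->
  (forall r, f (right_half q) r -> dom (Phi (left_half q)) r) /\
  exists2 r, f (right_half q) r & Phi (left_half q) r q'.
Proof.
have idP t : id_times f q t <->
    exists2 r, f (right_half q) r & t = bpair (left_half q) r.
  split=> [[a [b [-> [r fr ->]]]]|[r fr ->]].
    by rewrite bpairK1 bpairK2; exists r.
  exists (left_half q), (right_half q); split; first exact: bpair_eta.
  by exists r.
have UP a r t : U (bpair a r) t <-> Phi a r t.
  split=> [[b [s [E]]]|?]; last by exists a, r.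
  by have := congr1 left_half E; have := congr1 right_half E;
    rewrite !bpairK1 !bpairK2 => -> ->.
split=> [[H [t /idP[r fr ->] /UP Hr]]|[H [r fr Hr]]].
  split; last by exists r.
  move=> s fs; have [|t' /UP Ht'] := H (bpair (left_half q) s);
    last by exists t'.
  by apply/idP; exists s.
split; last by exists (bpair (left_half q) r); [apply/idP; exists r|apply/UP].
by move=> _ /idP[s /H[t Ht] ->]; exists t; apply/UP.
Qed.

(** The invariant contains every reachable state, not just those of one run, as the domain of the
    loop requires. An actual run comes from iterating a chosen successor. *)
Lemma inf_loop_run f q0 (P : nat -> baire -> Prop) :
  P 0 q0 -> (forall i q, P i q -> dom (loop_step f) q) ->
  (forall i q q', P i q -> loop_step f q q' -> P i.+1 q') ->
  dom (baire_inf_loop f) q0.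
Proof.
move=> P0 Pd PS; have stageP i : loop_stage f q0 i `<=` P i.
  elim: i => [_ ->//|i IH q [q' /IH Pq' /PS]]; exact.
have /choice[nxt Hnxt] q : exists q', dom (loop_step f) q -> loop_step f q q'.
  by have [[q' s]|nd] := pselect (dom (loop_step f) q); [exists q'|exists q].
have Pi i : P i (iter i nxt q0).
  by elim: i => //= i IH; apply: (PS _ _ _ IH); apply: Hnxt; exact: Pd IH.
exists (btuple (fun i => iter i nxt q0)); split.
  by move=> i q /stageP; exact: Pd.
by exists (fun i => iter i nxt q0); split=> // i; apply: Hnxt; exact: Pd (Pi i).
Qed.

Lemma inf_loop_inv f q0 t (P : nat -> baire -> Prop) :
  P 0 q0 -> (forall i q q', P i q -> loop_step f q q' -> P i.+1 q') ->
  baire_inf_loop f q0 t ->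
  exists q, [/\ t = btuple q, q 0 = q0, forall i, P i (q i) &
    forall i, loop_step f (q i) (q i.+1)].
Proof.
move=> P0 PS [_ [q [E Hs ->]]]; exists q; split=> //.
by elim=> [|i IH]; [rewrite E|exact: PS IH (Hs i)].
Qed.

(* From a prefix [u] of [q] and a prefix [v] of [x], the longest prefix of
   the value at [x] of the function with name [left_half q] that is visible. *)
Definition advance (u v : word) : word :=
  nat_rect (fun=> word) ([::] : word) (fun m a =>
    if ((CodeSeq.code (take m v)).*2 < size u) &&
       (size a < size (CodeSeq.decode (nth 0 u (CodeSeq.code (take m v)).*2)))
    then CodeSeq.decode (nth 0 u (CodeSeq.code (take m v)).*2) else a)
    (size v).+1.

Lemma cmp_advance (C : coded) (f g : C -> word) :
  cmp f -> cmp g -> cmp (fun x => advance (f x) (g x)).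
Proof.
move=> Hf Hg; rewrite /advance.
have H := cmp_fst (cmp_id (pair_coded C (pair_coded nat_coded word_coded))).
by have Hf' := cmp_comp Hf H; have Hg' := cmp_comp Hg H; cmp_tac.
Qed.

Lemma wprefix_advance u v q x q' : wprefix u q -> wprefix v x ->
  Phi (left_half q) x q' -> wprefix (advance u v) q'.
Proof.
move=> /wprefixP uq vx [H _]; rewrite /advance.
suff A N : N <= (size v).+1 -> wprefix (nat_rect (fun=> word) ([::] : word)
  (fun m a => if ((CodeSeq.code (take m v)).*2 < size u) &&
       (size a < size (CodeSeq.decode (nth 0 u (CodeSeq.code (take m v)).*2)))
    then CodeSeq.decode (nth 0 u (CodeSeq.code (take m v)).*2) else a) N) q'.
  exact: A.
elim: N => // m IH /= lem; case: ifP => [/andP[lt _]|_];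
  last exact: IH (ltnW lem).
by rewrite uq // vx take_mkseq //; exact: H.
Qed.

(** The doubled code is the position, within the state, of an entry of its even half, the program.
    Since [advance] keeps the longest value met, every visible entry bounds its length from
    below. *)
Lemma advance_size u v q x m : wprefix u q -> wprefix v x -> m <= size v ->
  (CodeSeq.code (mkseq x m)).*2 < size u ->
  size (word_fun (left_half q) (mkseq x m)) <= size (advance u v).
Proof.
move=> /wprefixP uq vx mv lt; rewrite /advance; have := mv; rewrite -ltnS.
elim: (size v).+1 => // N IH; rewrite [in X in X -> _]ltnS leq_eqVlt.
case/orP=> [/eqP E|/IH le] /=; last first.
  by case: ifP => // /andP[_ /ltnW]; exact: leq_trans.
rewrite -E [v in take m v]vx take_mkseq // lt uq //=.
by case: ltnP.
Qed.

Lemma wlim_advance u v q x q' : wlim u q -> wlim v x ->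
  Phi (left_half q) x q' -> wlim (fun n => advance (u n) (v n)) q'.
Proof.
move=> [u1 u2] [v1 v2] H; split=> [|M].
  by apply: evtS2 u1 v1 => n un vn; exact: wprefix_advance un vn H.
have [_ /(_ M)[m Hm]] := H.
have E := evtI (u2 (CodeSeq.code (mkseq x m)).*2.+1) (v2 m).
apply: evtS2 (evtI u1 v1) E => n [un vn] [lt le].
exact: leq_trans Hm (advance_size un vn le lt).
Qed.

Definition states (w X : word) i : word :=
  nat_rect (fun=> word) w (fun i u => advance u (wcomponent i X)) i.

Lemma cmp_states (C : coded) (f g : C -> word) (i : C -> nat) :
  cmp f -> cmp g -> cmp i -> cmp (fun x => states (f x) (g x) (i x)).
Proof.
move=> Hf Hg Hi; rewrite /states.
have H := cmp_id (pair_coded C (pair_coded nat_coded word_coded)).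
have Hg' := cmp_comp Hg (cmp_fst H).
apply: (@cmp_rec C word_coded) => //.
apply: cmp_advance; first by cmp_tac.
by apply: cmp_wcomponent => //; cmp_tac.
Qed.

Lemma wprefix_states w X (q : nat -> baire) (x : baire) i :
  wprefix w (q 0) -> wprefix X x ->
  (forall j, j < i -> Phi (left_half (q j)) (component x j) (q j.+1)) ->
  wprefix (states w X i) (q i).
Proof.
move=> w0 Xx; elim: i => // i IH H.
apply: wprefix_advance (H i (ltnSn i)); first by apply: IH => j /leqW; exact: H.
exact: wprefix_reindex.
Qed.

Lemma wlim_states w X (q : nat -> baire) (x : baire) i :
  wlim w (q 0) -> wlim X x ->
  (forall j, j < i -> Phi (left_half (q j)) (component x j) (q j.+1)) ->
  wlim (fun n => states (w n) (X n) i) (q i).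
Proof.
move=> w0 Xx; elim: i => // i IH H.
apply: wlim_advance (H i (ltnSn i)); first by apply: IH => j /leqW; exact: H.
exact: wlim_reindex.
Qed.

(** The start and the sequence of answers determine the whole run. This is the output side of both
    reductions of a loop, to closed choice and to [Lim]. *)
Definition wloop (w : word) : word := collect (fun k =>
  look (states (wleft w) (wright w) (Cantor.of_nat k).1) (Cantor.of_nat k).2)
  (size w).

Lemma cmp_wloop : cmp wloop.
Proof.
have H := cmp_id (pair_coded word_coded nat_coded).
apply: (@cmp_collect word_coded _ size); last exact: cmp_size (cmp_id _).
apply: cmp_look; last by cmp_tac.
by apply: cmp_states; [apply: cmp_wleft|apply: cmp_wright|]; cmp_tac.
Qed.

Lemma tracks_wloop q x :
  (forall i, Phi (left_half (q i)) (component x i) (q i.+1)) ->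
  tracks wloop (bpair (q 0) x) (btuple q).
Proof.
move=> H; have [HL1 HL2] := tracks_left (q 0) x.
have [HR1 HR2] := tracks_right (q 0) x.
apply: tracks_collect => [n|] k; rewrite /btuple; case: Cantor.of_nat => i j /=.
  by apply: look_wprefix; apply: wprefix_states (HL1 n) (HR1 n) _ => *;
    exact: H.
have [_ /(_ j.+1)] := wlim_states HL2 HR2 (fun j (_ : j < i) => H j).
by apply: evtS => n; rewrite look_gt0.
Qed.

Lemma tracks_mkseq (g : word -> nat -> nat) (p r : baire) :
  (forall n k, k < n -> g (mkseq p n) k = r k) ->
  tracks (fun w => mkseq (g w) (size w)) p r.
Proof.
move=> H; have E n : mkseq (g (mkseq p n)) (size (mkseq p n)) = mkseq r n.
  rewrite size_mkseq; apply: (@eq_from_nth _ 0); rewrite !size_mkseq // => k kn.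
  by rewrite !nth_mkseq // H.
split; first by move=> n; rewrite E; exact: wprefix_mkseq.
by rewrite (_ : (fun n => _) = mkseq r); [exact: wlim_mkseq|apply/funext].
Qed.

(** A stage or an index decoded from a position thus never refers to input beyond that position,
    which keeps the constructed names computable letter by letter. *)
Lemma of_nat_le n : (Cantor.of_nat n).1 + (Cantor.of_nat n).2 <= n.
Proof.
rewrite -{3}(Cantor.cancel_to_of n); case: Cantor.of_nat => x y /=.
by have := Cantor.to_nat_non_decreasing x y; lia.
Qed.

(** * Closed choice on Cantor and Baire space *)

(* [D] is the set of names of points: the 0-1 sequences for Cantor space, all
   sequences for Baire space. *)
Definition choice_on (D : set baire) : multi baire baire := fun s =>
  [set r | D r /\ forall i k, s i = k.+1 -> ~ wprefix (CodeSeq.decode k) r].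

(* Some component of [X] is visibly excluded by the instance of choice that
   the loop started at [w] reaches with the preceding components. *)
Definition refuted (w X : word) : bool := has (fun i =>
  has (fun j => (0 < nth 0 (wright (states w X i)) j) &&
    prefix (CodeSeq.decode (nth 0 (wright (states w X i)) j).-1)
      (wcomponent i X)) (iota 0 (size (wright (states w X i)))))
  (iota 0 (size w)).

Lemma cmp_refuted (C : coded) (f g : C -> word) :
  cmp f -> cmp g -> cmp (fun x => refuted (f x) (g x)).
Proof.
move=> Hf Hg; rewrite /refuted.
have H := cmp_id (pair_coded C nat_coded).
have HX := cmp_comp Hg (cmp_fst H).
have Hw := cmp_wright (cmp_states (cmp_comp Hf (cmp_fst H)) HX (cmp_snd H)).
have Hc := cmp_wcomponent (cmp_snd H) HX.
apply: cmp_has_iota; last exact: cmp_size.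
apply: cmp_has_iota; last exact: cmp_size.
have HF := cmp_fst (cmp_id (pair_coded (pair_coded C nat_coded) nat_coded)).
have Hw' := cmp_comp Hw HF; have Hc' := cmp_comp Hc HF.
by rewrite /= in Hw' Hc'; cmp_tac.
Qed.

(** A position codes a word and a stage, so that every word is tested against every finite prefix of
    the start: dovetailing yields a negative name of the set of unrefuted sequences. *)
Definition valid_name (w : word) n : nat :=
  if refuted (take (Cantor.of_nat n).2 w) (CodeSeq.decode (Cantor.of_nat n).1)
  then (Cantor.of_nat n).1.+1 else 0.

Lemma cmp_valid_name : cmp (fun w : word => mkseq (valid_name w) (size w) :
  word).
Proof.
apply: cmp_mkseq; last exact: cmp_size (cmp_id _); rewrite /valid_name.
have H := cmp_id (pair_coded word_coded nat_coded).
have Hr := @cmp_refuted _ (fun x : word * nat => take (Cantor.of_nat x.2).2 x.1)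
  (fun x => CodeSeq.decode (Cantor.of_nat x.2).1).
by apply: cmp_if; [apply: Hr|..]; cmp_tac.
Qed.

Section ChoiceLoop.
Variable D : set baire.
Hypothesis D_component : forall x i, D x -> D (component x i).
Hypothesis D_tuple : forall x, (forall i, D (x i)) -> D (btuple x).

Lemma refutedP w X q x : wprefix w (q 0) -> wprefix X x ->
  (forall j, Phi (left_half (q j)) (component x j) (q j.+1)) ->
  (forall j, choice_on D (right_half (q j)) (component x j)) -> ~ refuted w X.
Proof.
move=> wq Xx HPhi Hx /hasP[i _] /hasP[j]; rewrite mem_iota add0n /= => lt.
have /wprefixP HR := wprefix_reindex (fun k => k.*2.+1)
  (wprefix_states wq Xx (fun j (_ : j < i) => HPhi j)).
move=> /andP[]; rewrite (HR _ lt); case E: (q i _) => [//|k] _ /= pre.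
apply: ((Hx i).2 j k E); apply: wprefix_prefix pre.
exact: wprefix_reindex.
Qed.

(** State [i] is computed from the earlier components alone. If its instance excluded component [i],
    finite parts of both would show this at some stage, and the test would succeed there. *)
Lemma not_refuted_choice q x i :
  (forall n, ~ refuted (mkseq (q 0) n) (mkseq x n)) -> D x ->
  (forall j, j < i -> Phi (left_half (q j)) (component x j) (q j.+1)) ->
  choice_on D (right_half (q i)) (component x i).
Proof.
move=> Hr Dx HPhi; split=> [|j k E Hk]; first exact: D_component.
have HS := wlim_states (wlim_mkseq (q 0)) (wlim_mkseq x) HPhi.
have [S1 S2] := wlim_reindex (fun k => k.*2.+1) HS.
have [C1 C2] := wlim_reindex (fun k => Cantor.to_nat (i, k)) (wlim_mkseq x).
(* The stage has to show letter [j] of the instance and the whole excluded word in the component,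
   and to exceed [i], since [refuted] inspects only components below the size of its first
   argument. *)
have := evtI (evtI S1 (S2 j.+1)) (evtI (evtI C1 (C2 (size (CodeSeq.decode k))))
  (evt_ge i.+1)).
move=> [N /(_ N (leqnn _)) [[/wprefixP s1 s2] [[c1 c2] iN]]]; apply: (Hr N).
apply/hasP; exists i; first by rewrite mem_iota size_mkseq.
apply/hasP; exists j; first by rewrite mem_iota.
by rewrite /wright s1 // -[right_half (q i) j]/(q i _) in E *;
  rewrite [q i _]E /=; exact: wprefix_total Hk c1 c2.
Qed.

Lemma choice_loop :
  baire_reducible (baire_inf_loop (choice_on D)) (choice_on D).
Proof.
exists wloop, (fun w => mkseq (valid_name w) (size w)); split.
- exact: cmp_wloop.
- exact: cmp_valid_name.
move=> q0 [t [Hdom [q [q00 Hq _]]]].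
pose s n := valid_name (mkseq q0 (Cantor.of_nat n).2) n.
have validP x : choice_on D s x <->
    D x /\ forall m n, ~ refuted (mkseq q0 m) (mkseq x n).
  split=> -[Dx Hx]; split=> //.
    move=> m n Hn; apply: (Hx (Cantor.to_nat (CodeSeq.code (mkseq x n), m))
      (CodeSeq.code (mkseq x n))); last by rewrite CodeSeq.codeK;
        exact: wprefix_mkseq.
    by rewrite /s /valid_name !Cantor.cancel_of_to /= take_mkseq //
      CodeSeq.codeK Hn.
  move=> n k; rewrite /s /valid_name; case: ifP => // Hr [<-] Hp.
  by move: Hr; rewrite take_mkseq // Hp; exact: Hx.
have tracks_s : tracks (fun w => mkseq (valid_name w) (size w)) q0 s.
  apply: tracks_mkseq => n k kn; rewrite /s /valid_name !take_mkseq //.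
  by have := of_nat_le k; lia.
exists s; split=> //.
  have /choice[x Hx] i : exists x, choice_on D (right_half (q i)) x /\
      Phi (left_half (q i)) x (q i.+1).
    by have /loop_stepP[_ [x]] := Hq i; exists x.
  have Hc i : component (btuple x) i = x i by exact: component_btuple.
  exists (btuple x); apply/validP; split; first by apply: D_tuple => i;
    case: (Hx i) => -[].
  by move=> m n; apply: (@refutedP _ _ q (btuple x)) => [||j|j];
    rewrite ?q00 ?Hc; [exact: wprefix_mkseq..|exact: (Hx j).2|exact: (Hx j).1].
move=> x /validP[Dx Hx].
have /choice[nxt Hnxt] (iq : nat * baire) : exists q',
    dom (Phi (left_half iq.2)) (component x iq.1) ->
    Phi (left_half iq.2) (component x iq.1) q'.
  have [[q' H]|nd] := pselect (dom (Phi (left_half iq.2)) (component x iq.1)).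
    by exists q'.
  by exists q0.
pose r i := nat_rect (fun=> baire) q0 (fun i q => nxt (i, q)) i.
(* Inductively the states built from [x] are reachable, so the domain condition of the loop holds at
   them: the program is defined at every correct answer, in particular at the unrefuted component
   [i]. *)
have Hr i : loop_stage (choice_on D) q0 i (r i) /\
    forall j, j < i -> loop_step (choice_on D) (r j) (r j.+1) /\
      Phi (left_half (r j)) (component x j) (r j.+1).
  elim: i => [//|i [IH1 IH2]].
  have Hx' : choice_on D (right_half (r i)) (component x i).
    apply: not_refuted_choice => // j ji; exact: (IH2 j ji).2.
  have [q' /loop_stepP[HPhi _]] := Hdom i _ IH1.
  have Hn : Phi (left_half (r i)) (component x i) (r i.+1).
    exact: Hnxt (i, r i) (HPhi _ Hx').
  have Hs : loop_step (choice_on D) (r i) (r i.+1).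
    by apply/loop_stepP; split=> //; exists (component x i).
  split=> [|j]; first by exists (r i).
  by rewrite ltnS leq_eqVlt => /orP[/eqP ->|/IH2].
exists (btuple r); first by apply: (@tracks_wloop r x) => i;
  case: (Hr i.+1) => _ /(_ i (ltnSn i))[].
split=> //; exists r; split=> // i.
by case: (Hr i.+1) => _ /(_ i (ltnSn i))[].
Qed.

End ChoiceLoop.

(** * Closed choice, loops and limits in terms of names *)

Lemma realizer_closed_choice (X : based_space) p r :
  realizer_version (closed_choice X) p r <->
  exists2 y, delta X r y & forall i k, p i = k.+1 -> ~ base X k y.
Proof.
split=> [/realizer_versionE[y ry [_ [B pB By]]]|[y ry Hy]].
  exists y => // i k pi ky; have /= : (~` sval B) y by rewrite pB;
    exists k => //; exists i.
  exact.
(* Every sequence is a negative name, of the complement of the union it lists; hence no condition on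
   [p] remains. *)
pose V := \bigcup_(n in [set n | exists i, p i = n.+1]) base X n.
have cV : closed (~` V).
  apply: open_closedC; apply: bigcup_open => n _.
  by apply: (base_basis X).1; exists n.
apply/realizer_versionE; exists y => //.
have pV : delta (neg_closed X) p (exist _ (~` V) cV) by rewrite /= /neg_delta
  /= setCK.
have Vy : (~` V) y by move=> [k [i pi]]; exact: Hy pi.
apply: mcomp_single pV _ => //; exact: (@neg_single X).
Qed.

Lemma wprefix_cylinder (T : uniformType) (c : T -> nat) (x : nat -> T)
    (p : baire) w :
  (forall n, p n = c (x n)) -> wprefix w p <-> cylinder c w x.
Proof.
move=> px; rewrite /wprefix /cylinder /=.
have -> : mkseq (fun i => c (x i)) (size w) = mkseq p (size w).
  by apply: eq_mkseq => i; rewrite px.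
by split=> [<-|->].
Qed.

Lemma realizer_C_baire : realizer_version C_baire = choice_on setT.
Proof.
apply/funext => p; apply/seteqP; split=> r.
  move=> /realizer_closed_choice[y /= -> Hy]; split=> // i k pi Hw.
  exact: Hy i k pi (iffLR (@wprefix_cylinder nat id r r _ (fun=> erefl)) Hw).
move=> [_ Hr]; apply/realizer_closed_choice; exists r => // i k pi Hc.
exact: Hr i k pi (iffRL (@wprefix_cylinder nat id r r _ (fun=> erefl)) Hc).
Qed.

Lemma realizer_C_cantor :
  realizer_version C_cantor = choice_on [set r | forall n, r n <= 1].
Proof.
apply/funext => p; apply/seteqP; split=> r.
  move=> /realizer_closed_choice[y /= ry Hy]; split=> [n|i k pi Hw].
    by rewrite ry; case: (y n).
  exact: Hy i k pi (iffLR (wprefix_cylinder _ ry) Hw).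
move=> [r1 Hr]; apply/realizer_closed_choice.
have ry n : r n = nat_of_bool (r n == 1) by move: (r1 n); case: (r n) => [|[]].
exists (fun n => r n == 1) => // i k pi Hc.
exact: Hr i k pi (iffRL (wprefix_cylinder _ ry) Hc).
Qed.

Lemma realizer_C_nat p r :
  realizer_version C_nat p r <-> forall i, p i != (r 0).+1.
Proof.
split=> [/realizer_closed_choice[y /= -> Hy] i|H].
  by apply/eqP => pi; exact: (Hy i (r 0) pi).
apply/realizer_closed_choice; exists (r 0) => //= i k pi rk.
by have := H i; rewrite pi rk eqxx.
Qed.

Lemma realizer_inf_loop (X Y : repspace) (f : problem X Y) :
  realizer_version (inf_loop f) = baire_inf_loop (realizer_version f).
Proof. exact: realizer_version_baire. Qed.

Lemma LimP s r : Lim s r <-> forall n, evt (fun t => component s t n = r n).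
Proof.
split=> [H n|H].
  have : nbhs (r : baire) [set y : baire | y n = r n].
    apply: (@proj_continuous nat (fun=> nat) n r [set r n]).
    by apply: open_nbhs_nbhs; split=> //; exact: discrete_open.
  by move=> /H[N _ HN]; exists N => t; exact: HN.
apply/(@pointwise_cvgP nat nat (component s @ \oo) r) => n B /nbhs_singleton Br.
have [N HN] := H n; exists N => // t /= Nt.
by rewrite /= HN.
Qed.

(** * Self-reproducing programs *)

Section Program.
Variable E : baire -> baire -> baire.
Variable e : word -> word -> nat -> nat.
Hypothesis cmp_e : cmp (fun x : word * word * nat => e x.1.1 x.1.2 x.2).
Hypothesis eE : forall p r m k l, l < k -> CodeSeq.code (mkseq r k) <= m ->
  e (mkseq p m) (mkseq r k) l = E p r l.

(* Course-of-values recursion: the value at the code of [w] is a prefix, of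
   length [size w], of the pair of the program itself and of [E p r], where
   [r] extends [w]; since the code of [w] exceeds [size w] this only involves
   smaller values. *)
Definition program_step (P : word) n (T : word) : word :=
  rcons T (CodeSeq.code (mkseq (fun l =>
    if odd l then e (take n P) (CodeSeq.decode n) l./2 else nth 0 T l./2)
    (size (CodeSeq.decode n)))).

Definition program_table (P : word) n : word :=
  nat_rect (fun=> word) ([::] : word) (program_step P) n.

Definition program (p : baire) : baire :=
  fun n => nth 0 (program_table (mkseq p n) n.+1) n.

Lemma cmp_program_table (C : coded) (f : C -> word) (n : C -> nat) :
  cmp f -> cmp n -> cmp (fun x => program_table (f x) (n x)).
Proof.
move=> Hf Hn; rewrite /program_table.
apply: (@cmp_rec C word_coded) => //; first exact: cmp_cst.
rewrite /program_step.
have HF := cmp_fst (cmp_id (pair_coded C (pair_coded nat_coded word_coded))).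
have HF1 := cmp_comp Hf HF.
have HF2 := cmp_fst (cmp_id (pair_coded (pair_coded C
  (pair_coded nat_coded word_coded)) nat_coded)).
have HF3 := cmp_comp HF1 HF2.
have := @cmp_comp _ _ _ _ (fun x : C * (nat * word) * nat =>
  ((take x.1.2.1 (f x.1.1), CodeSeq.decode x.1.2.1), x.2./2)) cmp_e.
move=> /= /(_ _)H4.
apply: cmp_rcons; first by cmp_tac.
apply: cmp_code; apply: cmp_mkseq; last by cmp_tac.
by apply: cmp_if; [|apply: H4|]; cmp_tac.
Qed.

Lemma size_table P n : size (program_table P n) = n.
Proof. by elim: n => //= n IH; rewrite size_rcons IH. Qed.

(** Entry [n] of the table consults only the first [n] letters of [P], so [n] rows depend on the
    first [n.-1] letters. *)
Lemma table_take P n m : n <= m.+1 ->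
  program_table (take m P) n = program_table P n.
Proof.
elim: n => //= n IH nm; rewrite IH; last exact: ltnW.
by rewrite /program_step take_takel.
Qed.

Lemma nth_table P n m k : k < n -> n <= m ->
  nth 0 (program_table P m) k = nth 0 (program_table P n) k.
Proof.
move=> kn; elim: m => [|m IH]; first by rewrite leqn0 => /eqP E0;
  rewrite E0 in kn.
rewrite leq_eqVlt => /orP[/eqP ->//|]; rewrite ltnS => nm /=.
by rewrite /program_step nth_rcons size_table (leq_trans kn nm) IH.
Qed.

Lemma nth_program p N n k : k < n -> n <= N ->
  nth 0 (program_table (mkseq p N) n) k = program p k.
Proof.
move=> kn nN; rewrite (nth_table _ (ltnSn k) kn) /program.
by rewrite -(@take_mkseq p k N) ?table_take //; lia.
Qed.

Lemma word_fun_program p r n :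
  word_fun (program p) (mkseq r n) = mkseq (bpair (program p) (E p r)) n.
Proof.
rewrite /word_fun /program /= /program_step nth_rcons size_table ltnn eqxx.
rewrite !CodeSeq.codeK size_mkseq; set N := CodeSeq.code (mkseq r n).
have nN : n <= N by have := size_code (mkseq r n); rewrite size_mkseq.
apply: (@eq_from_nth _ 0); rewrite !size_mkseq // => l ln.
rewrite !nth_mkseq // /bpair take_mkseq //.
case: odd; first by apply: eE; lia.
by apply: nth_program => //; lia.
Qed.

Lemma Phi_program p r : Phi (program p) r (bpair (program p) (E p r)).
Proof.
split=> [n|M]; first by rewrite word_fun_program size_mkseq.
by exists M; rewrite word_fun_program size_mkseq.
Qed.

(** The parameter [p] is built into the program and travels with it, so the input of a reduction
    stays available at every later step of the loop. *)
Lemma self_program : exists S : baire -> baire, exists2 k, cmp k &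
  (forall p, tracks k p (S p)) /\
  forall p r, Phi (S p) r (bpair (S p) (E p r)).
Proof.
exists program.
exists (fun w => mkseq (nth 0 (program_table w (size w))) (size w)).
  apply: cmp_mkseq; last exact: cmp_size (cmp_id _).
  by apply: cmp_nth; [apply: cmp_program_table|]; cmp_tac.
split=> p; last exact: Phi_program.
apply: tracks_mkseq => n k kn; rewrite size_mkseq; exact: nth_program.
Qed.

End Program.

(** * Reducing a problem to its own loop *)

Definition wmap (d : nat -> nat) (w : word) : word :=
  mkseq (fun k => d (nth 0 w k)) (size w).

Lemma cmp_wmap (C : coded) (d : nat -> nat) (f : C -> word) :
  cmp d -> cmp f -> cmp (fun x => wmap d (f x)).
Proof.
move=> Hd Hf; apply: cmp_mkseq; last exact: cmp_size.
apply: (cmp_comp Hd);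
  have Hf' := cmp_comp Hf (cmp_fst (cmp_id (pair_coded C nat_coded))).
by cmp_tac.
Qed.

Lemma tracks_map d psi p r :
  tracks psi p r -> tracks (fun w => wmap d (psi w)) p (fun n => d (r n)).
Proof.
have H w q : wprefix w q -> wprefix (wmap d w) (fun n => d (q n)).
  move=> /wprefixP Hw; apply/wprefixP => i; rewrite size_mkseq => lti.
  by rewrite nth_mkseq // Hw.
move=> [H1 [H2 H3]]; split; first by move=> n; exact: H.
split=> [|M]; first by apply: evtS H2 => n; exact: H.
by apply: evtS (H3 M) => n; rewrite size_mkseq.
Qed.

(** The first step solves the given instance. From then on [E] turns each answer into some solvable
    instance, which keeps the loop alive, and the first answer is decoded by [g] and [d] from the
    instance in state 1. *)
Lemma baire_reducible_loop (f : multi baire baire) (E : baire -> baire)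
    (e : word -> nat -> nat) (g d : nat -> nat) :
  cmp (fun x : word * nat => e x.1 x.2) -> cmp g -> cmp d ->
  (forall r k l, l < k -> e (mkseq r k) l = E r l) ->
  (forall r, dom f (E r)) ->
  (forall p r, f p r -> f p (fun n => d (E r (g n)))) ->
  baire_reducible f (baire_inf_loop f).
Proof.
move=> Ce Cg Cd eE domE fE.
have [||S [k Hk [kS HPhi]]] := @self_program (fun _ => E) (fun _ => e).
- exact: (cmp_comp Ce (cmp_pair (cmp_snd (cmp_fst (cmp_id _))) (cmp_snd (cmp_id
  _)))).
- by move=> p r m n l ln _; exact: eE.
exists (fun w => wmap d (reindex g (wright (wcomponent 1 (wright w))))).
exists (fun w => wpair (k w) w); split.
- apply: (cmp_wmap Cd); apply: cmp_reindex.
    exact: cmp_comp Cg (cmp_snd (cmp_id _)).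
  apply: cmp_wright; apply: cmp_wcomponent; first exact: cmp_cst.
  exact: cmp_wright (cmp_id _).
- exact: cmp_wpair Hk (cmp_id _).
move=> p dp; exists (bpair (S p) p); split.
- exact: tracks_pair (kS p) (tracks_id p).
- apply: (@inf_loop_run _ _ (fun _ q =>
  left_half q = S p /\ dom f (right_half q))).
  + by rewrite bpairK1 bpairK2.
  + move=> _ q [q1 [r fr]]; exists (bpair (S p) (E r)); apply/loop_stepP;
    rewrite q1.
    by split=> [s _|]; [exists (bpair (S p) (E s))|exists r].
  + move=> _ q q' [q1 _] /loop_stepP[_ [r _]]; rewrite q1.
    move=> /word_sup_uniq/(_ (HPhi p r)) ->; rewrite bpairK1 bpairK2.
    by split.
- move=> t [_ [q [q0 Hq ->]]].
  have /loop_stepP[_ [r]] := Hq 0; rewrite q0 bpairK1 bpairK2 => fpr.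
  move=> /word_sup_uniq/(_ (HPhi p r)) q1.
  exists (fun n => d (E r (g n))); last exact: fE.
  apply: (@tracks_map d _ _ (fun n => E r (g n))); apply: tracks_reindex.
  rewrite -[E r](bpairK2 (S p)) -q1 -(component_btuple q).
  apply: tracks_reindex; apply: tracks_reindex; exact: tracks_right.
Qed.

(** The next instance excludes only one-letter words with a nonzero letter, so the zero sequence
    remains a solution, while the excluded letters record the answer. *)
Lemma choice_le_loop (D : set baire) : D (fun=> 0) ->
  baire_reducible (choice_on D) (baire_inf_loop (choice_on D)).
Proof.
move=> D0.
apply: (@baire_reducible_loop _ (fun r n => (CodeSeq.code [:: (r n).+1]).+1)
  (fun w n => (CodeSeq.code [:: (nth 0 w n).+1]).+1) id
  (fun y => (head 0 (CodeSeq.decode y.-1)).-1)).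
- by cmp_tac.
- exact: cmp_id.
- by cmp_tac.
- by move=> r k l lk; rewrite nth_mkseq.
- move=> r; exists (fun=> 0); split=> // i k /succn_inj <-.
  by rewrite CodeSeq.codeK.
- move=> p r [Dr Hr]; rewrite (_ : (fun n => _) = r) //.
  by apply/funext => n; rewrite succnK CodeSeq.codeK.
Qed.

(** The next instance is the constant sequence with value [r], from whose component 0 the answer is
    read back. *)
Lemma Lim_le_loop : baire_reducible Lim (baire_inf_loop Lim).
Proof.
apply: (@baire_reducible_loop _ (fun r n => r (Cantor.of_nat n).2)
  (fun w n => nth 0 w (Cantor.of_nat n).2) (fun n => Cantor.to_nat (0, n)) id).
- by cmp_tac.
- exact: (cmp_to_nat (cmp_pair (cmp_cst _ 0) (cmp_id _))).
- exact: cmp_id.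
- by move=> r k l lk; rewrite nth_mkseq //; have := of_nat_le l; lia.
- move=> r; exists r; apply/LimP => n; apply: evtT => t.
  by rewrite /component Cantor.cancel_of_to.
- move=> p r; rewrite (_ : (fun n => _) = r) //.
  by apply/funext => n; rewrite Cantor.cancel_of_to.
Qed.

(** The next instance excludes the single number [r 0]: this records the answer and leaves
    [(r 0).+1] as a solution. *)
Lemma C_nat_le_loop : baire_reducible (realizer_version C_nat)
  (baire_inf_loop (realizer_version C_nat)).
Proof.
apply: (@baire_reducible_loop _ (fun r n => if n == 0 then (r 0).+1 else 0)
  (fun w n => if n == 0 then (nth 0 w 0).+1 else 0) (fun=> 0) predn).
- by cmp_tac.
- by cmp_tac.
- by apply: cmp_pred; exact: cmp_id.
- by move=> r k l lk; rewrite nth_mkseq //; exact: leq_ltn_trans lk.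
- move=> r; exists (fun=> (r 0).+1); apply/realizer_C_nat => i.
  by case: (i == 0) => //; apply/eqP; lia.
- by move=> p r /realizer_C_nat H; apply/realizer_C_nat.
Qed.

(** * The loop of choice on the natural numbers *)

(* Instance [i] of choice asks for a position [a = <N, i>] in a sequence of
   sequences such that the [i]-th letter is constant from the [N]-th sequence
   on; the answer [y] stands for [a = y./2]. The first letter excludes an even
   number, which is harmless, and thereby records the value [v]. *)
Definition modulus_name (x : nat -> nat) i v n : nat :=
  if n == 0 then v.*2.+1 else
  let y := (Cantor.of_nat n.-1).1 in let c := (Cantor.of_nat n.-1).2 in
  if ((Cantor.of_nat y./2).2 != i) || (((Cantor.of_nat c).2 == i) &&
     (((Cantor.of_nat y./2).1 <= (Cantor.of_nat c).1) && (x c != x y./2)))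
  then y.+1 else 0.

Lemma modulus_name_prefix (p : baire) m i v n : n <= m ->
  modulus_name (nth 0 (mkseq p m)) i v n = modulus_name p i v n.
Proof.
rewrite /modulus_name; case: eqP => //= n0 nm; have := of_nat_le n.-1.
case: (Cantor.of_nat n.-1) => y c /= H.
by rewrite !nth_mkseq //; lia.
Qed.

Lemma modulus_nameP p r i v y : Lim p r ->
  (forall n, modulus_name p i v n != y.+1) ->
  (Cantor.of_nat y./2).2 = i /\ p y./2 = r i.
Proof.
move=> /LimP/(_ i)[N HN] Hy.
have H c : ((Cantor.of_nat y./2).2 != i) || (((Cantor.of_nat c).2 == i) &&
     (((Cantor.of_nat y./2).1 <= (Cantor.of_nat c).1) && (p c != p y./2))) =
       false.
  apply/negbTE/negP => Hc; have := Hy (Cantor.to_nat (y, c)).+1.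
  by rewrite /modulus_name /= Cantor.cancel_of_to /= Hc eqxx.
have Ei : (Cantor.of_nat y./2).2 = i.
  by apply/eqP; have /negbT := H 0; rewrite negb_or negbK => /andP[].
(* This position lies in column [i], late enough to carry the limit and not before the row of
   [y./2]; as [y] is not excluded, both letters agree. *)
split=> //; have := H (Cantor.to_nat (N + (Cantor.of_nat y./2).1, i)).
rewrite Cantor.cancel_of_to /= Ei !eqxx leq_addl /= => /negbFE/eqP <-.
by apply: HN; rewrite leq_addr.
Qed.

Lemma modulus_name_dom p r i v : Lim p r ->
  exists y, forall n, modulus_name p i v n != y.+1.
Proof.
(* The odd answer escapes the first letter, which excludes the even number [v.*2]. *)
move=> /LimP/(_ i)[N HN]; exists (Cantor.to_nat (N, i)).*2.+1 => n.
rewrite /modulus_name; case: (n == 0).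
  by apply/eqP; lia.
case: (Cantor.of_nat n.-1) => y c /=; case: ifP => // H.
apply/eqP => -[E]; move: H; rewrite E /= uphalf_double Cantor.cancel_of_to /=.
rewrite eqxx /= => /and3P[/eqP ci Nc]; rewrite -(Cantor.cancel_to_of c).
rewrite (surjective_pairing (Cantor.of_nat c)) ci.
have := HN _ Nc; have := HN N (leqnn N).
by rewrite /component => -> ->; rewrite eqxx.
Qed.

(** No step counter is carried along: the answer contains the index [i] as second coordinate, which
    gives the next index, and it points to a letter of [p] equal to the limit at [i]. *)
Definition next_name (p r : baire) : baire :=
  modulus_name p (Cantor.of_nat (r 0)./2).2.+1 (p (r 0)./2).

Lemma Lim_le_C_nat_loop :
  baire_reducible Lim (baire_inf_loop (realizer_version C_nat)).
Proof.
have [||S [k Hk [kS HPhi]]] := @self_program next_name (fun P w l =>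
  modulus_name (nth 0 P) (Cantor.of_nat (nth 0 w 0)./2).2.+1
    (nth 0 P (nth 0 w 0)./2) l).
- by rewrite /modulus_name; cmp_tac.
- move=> p r m n l ln Hm; have n0 : 0 < n by lia.
  (* A letter is smaller than the code of any word containing it, so position [(r 0)./2] of [p] is
     visible when the program entry at that code is computed. *)
  have r0 : r 0 < m.
    apply: leq_trans Hm; have /allP := CodeSeq.ltn_code (mkseq r n); apply.
    by apply/mapP; exists 0; rewrite ?mem_iota.
  have nm : n <= m.
    by apply: leq_trans Hm; have := size_code (mkseq r n); rewrite size_mkseq.
  rewrite modulus_name_prefix; last by lia.
  by rewrite !nth_mkseq //; lia.
(* State [n.+1] has at position 1 the first letter of its instance, [(r n).*2.+1], whose half is
   [r n]. *)
exists (fun w => wmap half (reindex (fun i => Cantor.to_nat (i.+1,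
  1)) (wright w))).
exists (fun w => wpair (k w) (mkseq (modulus_name (nth 0 w) 0 0) (size w)));
  split.
- apply: cmp_wmap; first exact: cmp_half (cmp_id _).
  by apply: cmp_reindex; [cmp_tac|apply: cmp_wright; exact: cmp_id].
- apply: cmp_wpair => //; apply: cmp_mkseq; last exact: cmp_size (cmp_id _).
  by rewrite /modulus_name; cmp_tac.
move=> p [r pr]; pose s i v : baire := modulus_name p i v.
have PS i q q' v : left_half q = S p -> right_half q = s i v ->
    loop_step (realizer_version C_nat) q q' ->
    left_half q' = S p /\ right_half q' = s i.+1 (r i).
  move=> q1 q2 /loop_stepP[_ [y]]; rewrite q1 q2 => /realizer_C_nat Hy.
  move=> /word_sup_uniq/(_ (HPhi p y)) ->; rewrite bpairK1 bpairK2.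
  by rewrite /next_name; have [-> ->] := modulus_nameP pr Hy.
exists (bpair (S p) (s 0 0)); split.
- apply: tracks_pair; first exact: kS.
  by apply: tracks_mkseq => n l /ltnW; exact: modulus_name_prefix.
- apply: (@inf_loop_run _ _ (fun i q => left_half q = S p /\
    exists v, right_half q = s i v)).
  + by rewrite bpairK1 bpairK2; split=> //; exists 0.
  + move=> i q [q1 [v q2]]; have [y Hy] := modulus_name_dom i v pr.
    exists (bpair (S p) (next_name p (fun=> y))); apply/loop_stepP;
      rewrite q1 q2.
    split=> [a _|]; first by exists (bpair (S p) (next_name p a)).
    by exists (fun=> y) => //; apply/realizer_C_nat.
  + move=> i q q' [q1 [v q2]] /(PS i q q' v q1 q2)[-> ->].
    by split=> //; exists (r i).
- move=> t /(@inf_loop_inv _ _ _ (fun i q => left_half q = S p /\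
    exists2 v, right_half q = s i v & 0 < i -> v = r i.-1)).
  case=> [||q [-> _ Hq _]].
  + by rewrite bpairK1 bpairK2; split=> //; exists 0.
  + move=> i q q' [q1 [v q2 _]] /(PS i q q' v q1 q2)[-> ->].
    by split=> //; exists (r i).
  exists r => //.
  have -> : r = (fun n => (btuple q (Cantor.to_nat (n.+1, 1)))./2).
    apply/funext => n; rewrite /btuple Cantor.cancel_of_to.
    have [_ [v Hv /(_ isT) /= E]] := Hq n.+1.
    have := congr1 (fun x : baire => x 0) Hv; rewrite /right_half /= => ->.
    by rewrite /s /modulus_name /= uphalf_double E.
  apply: (@tracks_map half _ _ (fun n => btuple q (Cantor.to_nat (n.+1, 1)))).
  by apply: tracks_reindex; exact: tracks_right.
Qed.

(* [guess w i] is the answer to the [i]-th instance of choice on the natural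
   numbers that is still possible after seeing the prefix [w] of the start of
   the loop, assuming the current guesses for the earlier instances. *)
Definition least_remaining (u : word) : nat :=
  nat_rect (fun=> nat) 0 (fun _ y => if y.+1 \in u then y.+1 else y) (size u).

Definition guess_states (w : word) i : word :=
  nat_rect (fun=> word) w (fun _ u =>
    advance u (mkseq (fun=> least_remaining (wright u)) (size w))) i.

Definition guess (w : word) i := least_remaining (wright (guess_states w i)).

Lemma cmp_least_remaining (C : coded) (f : C -> word) :
  cmp f -> cmp (fun x => least_remaining (f x)).
Proof.
move=> Hf; rewrite /least_remaining.
have Hf' := cmp_comp Hf (cmp_fst (cmp_id (pair_coded C (pair_coded nat_coded
  nat_coded)))).
by cmp_tac.
Qed.

Lemma cmp_guess (C : coded) (f : C -> word) (i : C -> nat) :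
  cmp f -> cmp i -> cmp (fun x => guess (f x) (i x)).
Proof.
move=> Hf Hi; apply: cmp_least_remaining; apply: cmp_wright.
apply: (@cmp_rec C word_coded) => //.
have H := cmp_id (pair_coded C (pair_coded nat_coded word_coded)).
have Hf' := cmp_comp Hf (cmp_fst H).
apply: cmp_advance; first by cmp_tac.
apply: cmp_mkseq; last by cmp_tac.
by apply: cmp_least_remaining; apply: cmp_wright; cmp_tac.
Qed.

(** The candidate rises by at most one per round and never passes [m]. A prefix with at least [m]
    letters that lists all numbers below [m] therefore brings it exactly to [m]. *)
Lemma wlim_least_remaining u (s : baire) m : wlim u s ->
  (forall i, s i != m.+1) -> (forall z, z < m -> exists i, s i = z.+1) ->
  evt (fun n => least_remaining (u n) = m).
Proof.
move=> [u1 u2] Hm Hlt.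
have /choice[j Hj] z : exists i, z < m -> s i = z.+1.
  by case: (ltnP z m) => [/Hlt[i]|_]; [exists i|exists 0].
have H := evt_forall (fun z (_ : z < m) => u2 (j z).+1).
apply: evtS2 (evtI u1 (u2 m)) H => n [un mn] Hn; rewrite /least_remaining.
have in_u z : z < m -> z.+1 \in u n.
  move=> zm; rewrite -(Hj z zm); have /wprefixP <- := un; last exact: Hn.
  by rewrite mem_nth // Hn.
have m_u : m.+1 \notin u n.
  apply/negP => /(nthP 0)[i lti E]; have := Hm i.
  by rewrite -(iffLR (wprefixP _ _) un) // E eqxx.
suff A k : nat_rect (fun=> nat) 0 (fun _ y =>
  if y.+1 \in u n then y.+1 else y) k
    = minn k m by rewrite A; exact/minn_idPr.
elim: k => [|k /= ->]; first by rewrite min0n.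
case: (ltnP k m) => km; first by rewrite in_u // (minn_idPl km).
by rewrite (negbTE m_u) (minn_idPr _) // leqW.
Qed.

Lemma C_nat_loop_le_Lim :
  baire_reducible (baire_inf_loop (realizer_version C_nat)) Lim.
Proof.
pose g (w : word) n := guess (take (Cantor.of_nat n).1 w)
  (Cantor.of_nat (Cantor.of_nat n).2).1.
exists wloop, (fun w => mkseq (g w) (size w)); split.
- exact: cmp_wloop.
- apply: cmp_mkseq; last exact: cmp_size (cmp_id _).
  by apply: cmp_guess; cmp_tac.
move=> q0 [t [Hdom _]].
have /choice[nxt Hnxt] q : exists mq : nat * baire,
    dom (loop_step (realizer_version C_nat)) q ->
    [/\ forall i, right_half q i != mq.1.+1,
      forall z, z < mq.1 -> exists i, right_half q i = z.+1,
      Phi (left_half q) (fun=> mq.1) mq.2 &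
      loop_step (realizer_version C_nat) q mq.2].
  have [[q' /loop_stepP[Hd [x /realizer_C_nat xq _]]]|nd] :=
    pselect (dom (loop_step (realizer_version C_nat)) q); last by exists (0, q).
  have ex : exists m, `[< forall i, right_half q i != m.+1 >].
    by exists (x 0); apply/asboolP.
  case: (ex_minnP ex) => m /asboolP Hm Hmin.
  have Hm' : realizer_version C_nat (right_half q) (fun=> m) by
    apply/realizer_C_nat.
  have [q'' Hq''] := Hd _ Hm'; exists (m, q'') => _ /=; split=> //.
    move=> z zm; apply: contrapT => nz; move: zm; rewrite ltnNge => /negP;
      apply.
    apply: Hmin; apply/asboolP => i; apply/eqP => E; apply: nz; by exists i.
  by apply/loop_stepP; split=> //; exists (fun=> m).
pose q i := iter i (fun q => (nxt q).2) q0; pose m i := (nxt (q i)).1.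
have Hstage i : loop_stage (realizer_version C_nat) q0 i (q i).
  elim: i => // i IH; exists (q i) => //.
  by case: (Hnxt _ (Hdom i _ IH)).
have Hq i := Hnxt _ (Hdom i _ (Hstage i)).
(* A wrong guess spoils the later states only until it is corrected, so the guesses settle one index
   after the other, on the run that always takes the least answer. *)
have Hguess i : wlim (fun n => guess_states (mkseq q0 n) i) (q i).
  elim: i => [|i IH]; first exact: wlim_mkseq.
  have [H1 H2 H3 _] := Hq i; apply: (wlim_advance IH _ H3).
  have E := wlim_least_remaining (wlim_reindex (fun k => k.*2.+1) IH) H1 H2.
  split=> [|M]; last by apply: evtS (evt_ge M) => n; rewrite !size_mkseq.
  apply: evtS E => n En; apply/wprefixP => k; rewrite size_mkseq => lt.
  by rewrite nth_mkseq //; exact: En.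
have Hm i : evt (fun n => guess (mkseq q0 n) i = m i).
  have [H1 H2 _ _] := Hq i.
  exact: wlim_least_remaining (wlim_reindex (fun k =>
    k.*2.+1) (Hguess i)) H1 H2.
pose p' n := g (mkseq q0 (Cantor.of_nat n).1) n.
pose X := btuple (fun i => fun=> m i).
have HX : Lim p' X.
  apply/LimP => n; apply: evtS (Hm (Cantor.of_nat n).1) => k.
  rewrite /component /p' /g /X /btuple Cantor.cancel_of_to /= take_mkseq //.
  by case: (Cantor.of_nat n).
exists p'; split.
- apply: tracks_mkseq => n k kn; rewrite /p' /g !take_mkseq //.
  by have := of_nat_le k; lia.
- by exists X.
move=> r /LimP Hr; have -> : r = X.
  apply/funext => n; move/LimP: HX => /(_ n)/(evtI (Hr n))[N /(_ N (leqnn N))].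
  by case=> <-.
exists (btuple q); first apply: (@tracks_wloop q X) => i.
  by rewrite component_btuple; case: (Hq i).
by split=> //; exists q; split=> // i; case: (Hq i).
Qed.

(** * Separations by Baire category *)

Definition extend (w : word) (p : baire) : baire :=
  fun i => if i < size w then nth 0 w i else p i.

Lemma wprefix_extend w p : wprefix w (extend w p).
Proof. by apply/wprefixP => i lti; rewrite /extend lti. Qed.

Lemma wprefix_mkseqP (p q : baire) n :
  wprefix (mkseq p n) q <-> forall i, i < n -> q i = p i.
Proof.
split=> [/wprefixP H i lti|H]; last first.
  by apply/wprefixP => i; rewrite size_mkseq => lti; rewrite nth_mkseq // H.
by rewrite -H ?size_mkseq // nth_mkseq.
Qed.

Lemma wprefix_mkseq_le (p q : baire) m n : m <= n ->
  wprefix (mkseq p n) q -> wprefix (mkseq p m) q.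
Proof.
by move=> mn /wprefix_mkseqP H; apply/wprefix_mkseqP => i im; apply: H; lia.
Qed.

Lemma prefix_mkseq w p n : wprefix w p -> size w <= n -> prefix w (mkseq p n).
Proof.
by move=> wp le; apply: wprefix_total wp (wprefix_mkseq p n) _;
  rewrite size_mkseq.
Qed.

(** Baire category by finite extension: requirements that are dense below [w] are met one by one. *)
Lemma baire_generic (w : word) (P : nat -> word -> Prop) :
  (forall n u, prefix w u -> exists2 v, prefix u v & P n v) ->
  exists2 p, wprefix w p & forall n, exists2 v, wprefix v p & P n v.
Proof.
move=> H; have /choice[nxt Hnxt] (nu : nat * word) : exists v,
    prefix w nu.2 -> prefix nu.2 v /\ P nu.1 v.
  have [/(H nu.1)[v uv Pv]|nw] := boolP (prefix w nu.2); first by exists v.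
  by exists [::].
(* The appended letter makes the words grow even where [nxt] adds nothing. *)
pose W n := nat_rect (fun=> word) w (fun n u => nxt (n, rcons u 0)) n.
have W0 n : prefix w (W n).
  elim: n => [|n IH]; first exact: prefix_refl.
  have /(Hnxt (n, _))[Hn _] : prefix w (rcons (W n) 0).
    exact: prefix_trans IH (prefix_rcons _ _).
  exact: prefix_trans IH (prefix_trans (prefix_rcons _ _) Hn).
have WS n : prefix (rcons (W n) 0) (W n.+1) /\ P n (W n.+1).
  by apply: (Hnxt (n, rcons (W n) 0));
    exact: prefix_trans (W0 n) (prefix_rcons _ _).
have Wle m n : m <= n -> prefix (W m) (W n).
  elim: n => [|n IH]; first by rewrite leqn0 => /eqP ->; exact: prefix_refl.
  rewrite leq_eqVlt => /orP[/eqP ->|]; first exact: prefix_refl.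
  rewrite ltnS => /IH mn; apply: prefix_trans mn (prefix_trans _ (WS n).1).
  exact: prefix_rcons.
have sW n : n <= size (W n).
  elim: n => // n IH; apply: leq_trans (size_prefix (WS n).1).
  by rewrite size_rcons.
have nW m n i : i < size (W m) -> i < size (W n) ->
  nth 0 (W m) i = nth 0 (W n) i.
  wlog mn : m n / m <= n => [hw im jn|im _].
    by case/orP: (leq_total m n) => mn; [exact: hw|apply/esym; exact: hw].
  have := Wle _ _ mn; rewrite prefixE => /eqP E.
  by rewrite -[in LHS]E nth_take.
pose p i := nth 0 (W i.+1) i.
have Wp n : wprefix (W n) p.
  by apply/wprefixP => i lti; apply: nW => //; exact: sW.
exists p; first exact: (Wp 0).
by move=> n; exists (W n.+1); [exact: Wp|exact: (WS n).2].
Qed.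

Definition cont_at (F : baire -> baire) (p : baire) := forall i, exists l,
  forall p', wprefix (mkseq p l) p' -> F p' i = F p i.

Lemma cont_at_mkseq F p n : cont_at F p -> exists l,
  forall p', wprefix (mkseq p l) p' -> mkseq (F p') n = mkseq (F p) n.
Proof.
move=> HF; have /choice[l Hl] i : exists l, forall p', wprefix (mkseq p l) p' ->
    F p' i = F p i by exact: HF.
exists (\sum_(i < n) l i) => p' Hp'; apply: (@eq_from_nth _ 0).
  by rewrite !size_mkseq.
move=> i; rewrite size_mkseq => lti; rewrite !nth_mkseq //; apply: Hl.
apply: wprefix_mkseq_le Hp'.
by rewrite (bigD1 (Ordinal lti)) //= leq_addr.
Qed.

(** Letter [i] of the output already appears on a finite prefix of [F p], which nearby points share.
    Hence outputs picked by choice still depend continuously on the point. *)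
Lemma cont_at_tracks h F p r i : cont_at F p -> tracks h (F p) r -> exists l,
  forall p' r', wprefix (mkseq p l) p' -> tracks h (F p') r' -> r' i = r i.
Proof.
move=> HF [H1 [_ /(_ i.+1)[n /(_ n (leqnn n)) Hn]]].
have [l Hl] := cont_at_mkseq n HF; exists l => p' r' /Hl E [H1' _].
have /wprefixP <- := H1' n; last by rewrite E.
by rewrite E; have /wprefixP -> := H1 n.
Qed.

Lemma cont_at_bpair F G p : cont_at F p -> cont_at G p ->
  cont_at (fun p => bpair (F p) (G p)) p.
Proof.
move=> HF HG i; have [l Hl] := HF i./2; have [m Hm] := HG i./2.
exists (l + m) => p' H; rewrite /bpair; case: odd; [apply: Hm|apply: Hl];
  by apply: wprefix_mkseq_le H; lia.
Qed.

Definition range_approx (p : baire) : baire := fun n =>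
  (Cantor.of_nat n).2 \in mkseq p (Cantor.of_nat n).1.

Definition range_of (p : baire) : baire := fun n => `[< exists k, p k = n >].

Lemma Lim_range p : Lim (range_approx p) (range_of p).
Proof.
apply/LimP => n; rewrite /component /range_approx /range_of.
case: asboolP => [[k pk]|nk].
  exists k.+1 => t kt; rewrite Cantor.cancel_of_to /=.
  suff -> : n \in mkseq p t by [].
  by apply/mapP; exists k; rewrite ?mem_iota.
apply: evtT => t; rewrite Cantor.cancel_of_to /=.
suff /negbTE -> : n \notin mkseq p t by [].
by apply/mapP => -[k _ E]; apply: nk; exists k.
Qed.

Lemma cont_range_approx p : cont_at range_approx p.
Proof.
move=> i; exists i => p' /(wprefix_mkseq_le (m := (Cantor.of_nat i).1)) H.
rewrite /range_approx; suff -> : mkseq p' (Cantor.of_nat i).1 =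
  mkseq p (Cantor.of_nat i).1 by [].
by rewrite H ?size_mkseq //; have := of_nat_le i; lia.
Qed.

Lemma Lim_uniq s r r' : Lim s r -> Lim s r' -> r = r'.
Proof.
move=> /LimP H /LimP H'; apply/funext => n.
by have [N /(_ N (leqnn N))[<- <-]] := evtI (H n) (H' n).
Qed.

Lemma Lim_not_le_C_nat : ~ baire_reducible Lim (realizer_version C_nat).
Proof.
move=> [h [k [_ _ H]]].
have /choice[s Hs] p : exists s, [/\ tracks k (range_approx p) s,
    dom (realizer_version C_nat) s & forall r, realizer_version C_nat s r ->
      tracks h (bpair (range_approx p) r) (range_of p)].
  have [|s [ks ds hs]] := H (range_approx p).
    by exists (range_of p); exact: Lim_range.
  exists s; split=> // r /hs[t ht pt].
  by rewrite (Lim_uniq (@Lim_range p) pt).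
(* Otherwise excluding [n] would be a dense open condition for every [n], and a generic point would
   have an instance without answers. *)
have [w [n Hwn]] : exists w n, forall p, wprefix w p -> forall i, s p i != n.+1.
  apply: contrapT => Hno.
  have [n u _|p _ Hp] := @baire_generic [::] (fun n v =>
    forall p, wprefix v p -> exists i, s p i = n.+1).
    have [p up [i pi]] : exists2 p, wprefix u p & exists i, s p i = n.+1.
      apply: contrapT => Hno'; apply: Hno; exists u, n => p up i.
      by apply/eqP => E; apply: Hno'; exists p => //; exists i.
    have [ks _ _] := Hs p;
      have [l Hl] := cont_at_tracks i (@cont_range_approx p) ks.
    exists (mkseq p (l + size u)); first by apply: prefix_mkseq up _;
      exact: leq_addl.
    move=> p' Hp'; exists i; rewrite -pi; have [ks' _ _] := Hs p'.
    by apply: Hl ks'; apply: wprefix_mkseq_le Hp'; lia.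
  have [_ [r /realizer_C_nat Hr] _] := Hs p.
  have [v /[swap] /[apply] -[i Ei]] := Hp (r 0).
  by have := Hr i; rewrite Ei eqxx.
have Hr p : wprefix w p ->
  tracks h (bpair (range_approx p) (fun=> n)) (range_of p).
  move=> /Hwn wp; have [_ _ hs] := Hs p; apply: hs; exact/realizer_C_nat.
(* [a] is nonzero and larger than all letters of [w], so it is not a value of [p0], while [p1] takes
   it beyond any given prefix. *)
pose p0 := extend w (fun=> 0); pose a := (CodeSeq.code w).+1.
have Hc : cont_at (fun p => bpair (range_approx p) (fun=> n)) p0.
  by apply: cont_at_bpair; [exact: cont_range_approx|move=> i; exists 0].
have [l Hl] := cont_at_tracks a Hc (Hr _ (wprefix_extend _ _)).
pose p1 := extend (mkseq p0 (l + size w)) (fun=> a).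
have Hp1 : wprefix (mkseq p0 (l + size w)) p1 by exact: wprefix_extend.
have wp1 : wprefix w p1.
  by apply: wprefix_prefix Hp1 _; apply: prefix_mkseq;
    [exact: wprefix_extend|lia].
have := Hl p1 _ (wprefix_mkseq_le (leq_addr _ _) Hp1) (Hr _ wp1).
rewrite /range_of; case: asboolP => [_|[]]; last first.
  by exists (l + size w); rewrite /p1 /extend size_mkseq ltnn.
case: asboolP => // -[j]; rewrite /p0 /extend; case: ifP => // jw E.
have /allP/(_ (nth 0 w j) (mem_nth _ jw)) := CodeSeq.ltn_code w.
by rewrite E /a ltnNge leqnSn.
Qed.

(* The coordinates of a limit of continuous functions that converge everywhere
   are constant on densely many cylinders: otherwise one builds by extension a
   point where the [j]-th coordinate changes infinitely often. *)
Lemma Lim_locally_constant (s r : baire -> baire) :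
  (forall p, cont_at s p) -> (forall p, Lim (s p) (r p)) ->
  forall w j, exists2 v, prefix w v &
    exists c, forall p, wprefix v p -> r p j = c.
Proof.
move=> Hs Hr w j; apply: contrapT => Hno.
have [T u wu|p wp Hp] := @baire_generic w (fun T v => forall p, wprefix v p ->
    exists2 t, T <= t & component (s p) t j <> component (s p) T j).
  have [p up [t Tt ne]] : exists2 p, wprefix u p &
      exists2 t, T <= t & component (s p) t j <> component (s p) T j.
    apply: contrapT => Hno'; apply: Hno.
    have Hc p : wprefix u p -> r p j = component (s p) T j.
      move=> up; have /LimP/(_ j)[N HN] := Hr p.
      rewrite -(HN (N + T)) ?leq_addr //; apply: contrapT => ne.
      by apply: Hno'; exists p => //; exists (N + T); rewrite ?leq_addl.
    have [l Hl] := Hs (extend u (fun=> 0)) (Cantor.to_nat (T, j)).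
    have up := wprefix_extend u (fun=> 0).
    have uv := prefix_mkseq up (leq_addl l (size u)).
    exists (mkseq (extend u (fun=> 0)) (l + size u)).
      exact: prefix_trans wu uv.
    exists (component (s (extend u (fun=> 0))) T j) => p vp.
    rewrite Hc; last exact: wprefix_prefix vp uv.
    by apply: Hl; apply: wprefix_mkseq_le vp; exact: leq_addr.
  have [l Hl] := Hs p (Cantor.to_nat (t, j)).
  have [m Hm] := Hs p (Cantor.to_nat (T, j)).
  exists (mkseq p (l + m + size u)).
    by apply: prefix_mkseq up _; exact: leq_addl.
  move=> p' Hp'; exists t => //; rewrite /component Hl ?Hm //;
    by apply: wprefix_mkseq_le Hp'; lia.
have /LimP/(_ j)[N HN] := Hr p.
have [v vp /(_ p vp)[t Nt]] := Hp N.
by rewrite (HN t Nt) (HN N (leqnn N)).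
Qed.

Lemma Lim_continuity_point (s r : baire -> baire) :
  (forall p, cont_at s p) -> (forall p, Lim (s p) (r p)) ->
  exists p, cont_at r p.
Proof.
move=> Hs Hr; have [j u _|p _ Hp] := @baire_generic [::] (fun j v =>
    exists c, forall p, wprefix v p -> r p j = c).
  exact: Lim_locally_constant.
exists p => j; have [v vp [c Hc]] := Hp j; exists (size v) => p' Hp'.
by rewrite !Hc // (vp : v = _).
Qed.

(* [eventually_zero] is an iterated limit of continuous functions without
   points of continuity. It is constant as a sequence, hence a fixed point of
   [Lim], so that the loop can go on after the second step. *)
Definition zero_from (p : baire) i : bool := `[< forall k, i <= k -> p k = 0 >].

Definition zero_approx (p : baire) : baire := fun n =>
  let t := (Cantor.of_nat n).1 in let i :=
    (Cantor.of_nat (Cantor.of_nat n).2).1 in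
  all (fun k => (i <= k) ==> (p k == 0)) (iota 0 t).

Definition zero_levels (p : baire) : baire := fun n =>
  zero_from p (Cantor.of_nat n).1.

Definition eventually_zero (p : baire) : baire := fun=>
  `[< exists i, zero_from p i >].

Lemma Lim_zero_approx p : Lim (zero_approx p) (zero_levels p).
Proof.
apply/LimP => n; rewrite /component /zero_approx /zero_levels /zero_from.
case: asboolP => [H|nH].
  apply: evtT => t; rewrite Cantor.cancel_of_to /= (_ : all _ _ = true) //.
  by apply/allP => k _; apply/implyP => /H ->.
have [k ik pk] : exists2 k, (Cantor.of_nat n).1 <= k & p k <> 0.
  by apply: contrapT => nk; apply: nH => k ik; apply: contrapT => pk;
    apply: nk; exists k.
exists k.+1 => t kt; rewrite Cantor.cancel_of_to /= (_ : all _ _ = false) //.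
apply/negbTE/allPn; exists k; first by rewrite mem_iota.
by rewrite ik /=; apply/eqP.
Qed.

Lemma Lim_zero_levels p : Lim (zero_levels p) (eventually_zero p).
Proof.
apply/LimP => n; rewrite /component /zero_levels /eventually_zero.
case: asboolP => [[i /asboolP Hi]|H].
  exists i => t it; rewrite Cantor.cancel_of_to /=.
  suff -> : zero_from p t by [].
  by apply/asboolP => k tk; apply: Hi; exact: leq_trans tk.
apply: evtT => t; rewrite Cantor.cancel_of_to /=.
by case E: zero_from => //; case: H; exists t.
Qed.

Lemma cont_zero_approx p : cont_at zero_approx p.
Proof.
move=> n; exists n => p' /wprefix_mkseqP H; rewrite /zero_approx;
  congr nat_of_bool.
apply: eq_in_all => k; rewrite mem_iota add0n => /= kt; rewrite H //.
by have := of_nat_le n; lia.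
Qed.

(** The program hands each limit on as the next instance, so state 2 holds the double limit. A
    reduction would make it continuous wherever the single answer of [Lim] is continuous, and such a
    point exists. *)
Lemma Lim_loop_not_le_Lim : ~ baire_reducible (baire_inf_loop Lim) Lim.
Proof.
move=> [h [k [_ _ H]]].
have [||S [_ _ [_ /(_ (fun=> 0)) HPhi]]] :=
  @self_program (fun _ r => r) (fun _ w n => nth 0 w n).
- by cmp_tac.
- by move=> p r m n l ln _; rewrite nth_mkseq.
move: {S}(S _) HPhi => S HPhi.
pose A p i := match i with
  | 0 => zero_approx p | 1 => zero_levels p | _ => eventually_zero p end.
have HA p i : Lim (A p i) (A p i.+1).
  case: i => [|[|i]]; [exact: Lim_zero_approx|exact: Lim_zero_levels|].
  by apply/LimP => n; exact: evtT.
pose q0 p := bpair S (zero_approx p).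
pose inv p i q := left_half q = S /\ right_half q = A p i.
have inv0 p : inv p 0 (q0 p) by rewrite /inv bpairK1 bpairK2.
have invS p i q q' : inv p i q -> loop_step Lim q q' -> inv p i.+1 q'.
  move=> [q1 q2] /loop_stepP[_ [r]]; rewrite q1 q2 => Hr.
  move=> /word_sup_uniq/(_ (HPhi r)) ->.
  by rewrite /inv bpairK1 bpairK2 (Lim_uniq Hr (HA p i)).
have Hdom p : dom (baire_inf_loop Lim) (q0 p).
  apply: (inf_loop_run (inv0 p)) => [i q [q1 q2]|]; last exact: invS.
  exists (bpair S (A p i.+1)); apply/loop_stepP; rewrite q1 q2.
  split=> [r _|]; first by exists (bpair S r).
  by exists (A p i.+1).
have /choice[sr Hsr] p : exists sr : baire * baire, [/\ tracks k (q0 p) sr.1,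
    Lim sr.1 sr.2 & exists2 t, tracks h (bpair (q0 p) sr.2) t &
      baire_inf_loop Lim (q0 p) t].
  have [s [ks [r sr] hs]] := H _ (Hdom p); exists (s, r); split=> //; exact: hs.
have Hq0 p : cont_at q0 p.
  by apply: cont_at_bpair; [move=> i; exists 0|exact: cont_zero_approx].
have [|p|p Hp] := @Lim_continuity_point (fun p => (sr p).1) (fun p => (sr p).2).
- move=> p i; have [ks _ _] := Hsr p.
  have [l Hl] := cont_at_tracks i (Hq0 p) ks; exists l => p' Hp'.
  by have [ks' _ _] := Hsr p'; exact: Hl ks'.
- by have [] := Hsr p.
(* Position 1 of state 2 is the first letter of the right half. *)
pose a := Cantor.to_nat (2, 1).
have Ht p' : exists2 t, tracks h (bpair (q0 p') (sr p').2) t &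
    t a = eventually_zero p' 0.
  have [_ _ [t ht lt]] := Hsr p'; exists t => //.
  have [q [-> _ /(_ 2)[_ q2] _]] := inf_loop_inv (inv0 p') (@invS p') lt.
  by rewrite /btuple Cantor.cancel_of_to -[LHS]/(right_half (q 2) 0) q2.
have [t ht ta] := Ht p.
have [l Hl] := cont_at_tracks a (cont_at_bpair (Hq0 p) Hp) ht.
(* Continuing the same prefix by zeros or by ones gives different values. *)
have same c : eventually_zero (extend (mkseq p l) (fun=> c)) 0 = t a.
  have [t' ht' <-] := Ht (extend (mkseq p l) (fun=> c)).
  by apply: Hl ht'; exact: wprefix_extend.
have := same 0; rewrite -(same 1) /eventually_zero.
case: asboolP => [_|[]]; last first.
  exists l; apply/asboolP => n ln.
  by rewrite /extend size_mkseq ltnNge ln.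
case: asboolP => // -[i /asboolP/(_ (i + l) (leq_addr _ _))].
by rewrite /extend size_mkseq ltnNge leq_addl.
Qed.

Theorem theorem1 :
  (inf_loop C_cantor =W= C_cantor /\ inf_loop C_baire =W= C_baire) /\
  (C_nat <W Lim /\ Lim =W= inf_loop C_nat /\ inf_loop C_nat <W inf_loop Lim).
Proof.
have rL : realizer_version Lim = Lim by exact: realizer_version_baire.
split; split.
- split; apply: baire_reducible_weihrauch;
  rewrite realizer_inf_loop realizer_C_cantor.
    apply: choice_loop => [x i Dx n|x Dx n]; first exact: Dx.
    by rewrite /btuple; case: Cantor.of_nat => i j; exact: Dx.
  exact: choice_le_loop.
- split; apply: baire_reducible_weihrauch;
  rewrite realizer_inf_loop realizer_C_baire.
    exact: choice_loop.
  exact: choice_le_loop.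
- split; last by move/weihrauch_baire_reducible; rewrite rL;
  exact: Lim_not_le_C_nat.
  apply: baire_reducible_weihrauch; rewrite rL.
  exact: baire_reducible_trans C_nat_le_loop C_nat_loop_le_Lim.
- split; first split.
  + by apply: baire_reducible_weihrauch; rewrite rL realizer_inf_loop;
    exact: Lim_le_C_nat_loop.
  + by apply: baire_reducible_weihrauch; rewrite rL realizer_inf_loop;
    exact: C_nat_loop_le_Lim.
  split.
    apply: baire_reducible_weihrauch; rewrite !realizer_inf_loop rL.
    exact: baire_reducible_trans C_nat_loop_le_Lim Lim_le_loop.
  move/weihrauch_baire_reducible; rewrite !realizer_inf_loop rL => H.
  exact: Lim_loop_not_le_Lim (baire_reducible_trans H C_nat_loop_le_Lim).
Qed.
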